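(* Let $\mathbb{H}$ be a localic triangulated $\mathcal{S}$-fibered category, and let $(\otimes,m)$ be a localic internal tensor structure on the underlying $\mathcal{U}$-fibered category $\mathbb{H}$. Then there exists a triangulated internal tensor structure $(\tilde{\otimes},\tilde{m})$ on the $\mathcal{S}$-fibered category $\mathbb{H}$ whose restriction to $\mathcal{U}$ coincides with $(\otimes,m)$, and it is unique up to unique equivalence (restricting to the identity over $\mathcal{U}$). Moreover, the internal tensor structure $(\tilde{\otimes},\tilde{m})$ is automatically localic.
   Context: Base category. $\mathcal{S}$ is a fixed small category with finite products and final object $\ast$, equipped with two (possibly non-full) subcategories $\mathcal{S}^{sm}$ (its morphisms are called smooth morphisms) and $\mathcal{S}^{cl}$ (its morphisms are called closed immersions) such that: (i) both have the same objects as $\mathcal{S}$ and contain all isomorphisms of $\mathcal{S}$; (ii) for every smooth $p: P \to S$ and every $f: T \to S$ in $\mathcal{S}$ the fibered product $P\times_S T$ exists in $\mathcal{S}$ and its projection to $T$ is smooth; (iii) for every smooth $p: P\to S$ and closed immersion $z: Z\to S$ the projection $P\times_S Z\to P$ is a closed immersion, and whenever $z: Z\to S$, $g: S\to V$ are morphisms of $\mathcal{S}$ with $gz$ a closed immersion, $z$ is a closed immersion; (iv) every $f: T\to S$ in $\mathcal{S}$ factors as $f=p\circ t$ with $t: T\to P$ a closed immersion and $p: P\to S$ smooth. $\mathcal{U}$ is the full subcategory of $\mathcal{S}$ of all $Y$ such that $Y\to\ast$ is smooth; its smooth morphisms and closed immersions are those of $\mathcal{S}$ lying in $\mathcal{U}$.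 Moreover: (v) $\mathcal{S}$ has an initial object $\emptyset$; (vi) for every closed immersion $z: Z\to S$ there is a distinguished smooth morphism $u: U\to S$ (the open immersion complementary to $z$; $U$ is the open complement of $Z$ in $S$) such that for every $T\in\mathcal{S}$ composition with $u$ identifies $\mathrm{Hom}_{\mathcal{S}}(T,U)$ with the subset of those $f\in\mathrm{Hom}_{\mathcal{S}}(T,S)$ for which the square with sides $\emptyset\to T$, $f:T\to S$, $\emptyset\to Z$, $z: Z\to S$ is Cartesian; (vii) for every $S\in\mathcal{S}$ there is a finite sequence of closed immersions $\emptyset=Z_{-1}\to Z_0\to\cdots\to Z_n=S$ such that for each $r=0,\dots,n$ the open complement of $Z_{r-1}$ in $Z_r$ belongs to $\mathcal{U}$. Fibered categories. Let $\mathcal{C}$ be $\mathcal{S}$ or $\mathcal{U}$. A $\mathcal{C}$-fibered category $\mathbb{H}$ consists of a category $\mathbb{H}(S)$ for each $S\in\mathcal{C}$, a functor $f^*:\mathbb{H}(S)\to\mathbb{H}(T)$ for each $f: T\to S$ in $\mathcal{C}$, and natural isomorphisms $\mathsf{conn}_{f,g}:(gf)^*\xrightarrow{\sim} f^*g^*$ for composable $f: T\to S$, $g: S\to V$, such that $\mathrm{id}_S^*=\mathrm{id}_{\mathbb{H}(S)}$ and, for composable $f,g,h$, the two resulting isomorphisms $(hgf)^*\xrightarrow{\sim} f^*g^*h^*$ agree. Connection isomorphisms are written as equalities. An $\mathcal{S}$-fibered category restricts to a $\mathcal{U}$-fibered category, denoted by the same symbol. Localic fibered categories. A triangulated $\mathcal{C}$-fibered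 category is one where all $\mathbb{H}(S)$ are triangulated categories, all $f^*$ are triangulated functors and all connection isomorphisms are isomorphisms of triangulated functors. It is localic if: (a) $\mathbb{H}(\emptyset)=0$; (b) for every smooth $p: P\to S$ the functor $p^*$ has a left adjoint $p_\#$, and for every Cartesian square with $p: P\to S$ smooth, $f: T\to S$, $p': P_T\to T$, $f': P_T\to P$, the composite $p'_\#f'^*\xrightarrow{\eta}p'_\#f'^*p^*p_\#=p'_\#p'^*f^*p_\#\xrightarrow{\epsilon}f^*p_\#$ is invertible; (c) for every closed immersion $z: Z\to S$ the functor $z^*$ has a right adjoint $z_*$, which is fully faithful; (d) for every closed immersion $z$ with complementary open immersion $u$, the pair $(z^*,u^* )$ is conservative. Here $\eta$ and $\epsilon$ denote units and co-units of adjunctions. A localic $\mathcal{S}$-fibered category restricts to a localic $\mathcal{U}$-fibered category. Tensor structures. An internal tensor structure $(\otimes,m)$ on a $\mathcal{C}$-fibered category $\mathbb{H}$ consists of functors $-\otimes-:\mathbb{H}(S)\times\mathbb{H}(S)\to\mathbb{H}(S)$ for $S\in\mathcal{C}$ and natural isomorphisms $m_f: f^*A\otimes f^*B\xrightarrow{\sim}f^*(A\otimes B)$ for $f: T\to S$ in $\mathcal{C}$ such that for composable $f,g$ the isomorphism $m_{gf}$ equals the composite $f^*g^*A\otimes f^*g^*B\xrightarrow{m_f}f^*(g^*A\otimes g^*B)\xrightarrow{m_g}f^*g^*(A\otimes B)$ (modulo connection isomorphisms). It is triangulated if the functors $\otimes$ are bi-triangulated and the $m_f$ are isomorphisms of bi-triangulated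 functors. A triangulated internal tensor structure is localic if for every smooth $p: P\to S$ in $\mathcal{C}$ the composites $p_\#(A\otimes p^*B)\xrightarrow{\eta}p_\#(p^*p_\#A\otimes p^*B)\xrightarrow{m}p_\#p^*(p_\#A\otimes B)\xrightarrow{\epsilon}p_\#A\otimes B$ and $p_\#(p^*A\otimes B)\xrightarrow{\eta}p_\#(p^*A\otimes p^*p_\#B)\xrightarrow{m}p_\#p^*(A\otimes p_\#B)\xrightarrow{\epsilon}A\otimes p_\#B$ are invertible. An equivalence $(\otimes,m)\to(\otimes',m')$ is a family of natural isomorphisms $e_S: A\otimes B\xrightarrow{\sim}A\otimes'B$, $S\in\mathcal{C}$, such that $m'_f\circ e_T=f^*(e_S)\circ m_f$ for every $f: T\to S$. *)

(* Defs.v *)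
From mathcomp Require Import all_boot ssralg.

Set Implicit Arguments.
Unset Strict Implicit.
Unset Printing Implicit Defensive.

Import GRing.Theory.

Declare Scope cat_scope.
Delimit Scope cat_scope with cat.
Local Open Scope ring_scope.
Local Open Scope cat_scope.

Reserved Notation "g \c f" (at level 40, left associativity).

Record category := Category {
  ob :> Type;
  hom : ob -> ob -> Type;
  idm : forall X, hom X X;
  mcomp : forall X Y Z, hom Y Z -> hom X Y -> hom X Z;
  mcomp_idl : forall X Y (f : hom X Y), mcomp (idm Y) f = f;
  mcomp_idr : forall X Y (f : hom X Y), mcomp f (idm X) = f;
  mcompA : forall X Y Z W (h : hom Z W) (g : hom Y Z) (f : hom X Y),
    mcomp h (mcomp g f) = mcomp (mcomp h g) f
}.
Arguments idm {c} X.
Arguments hom {c} X Y.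

Notation "g \c f" := (mcomp g f) : cat_scope.

Definition is_iso (C : category) (X Y : C) (f : hom X Y) : Prop :=
  exists g : hom Y X, g \c f = idm X /\ f \c g = idm Y.

Definition eq_hom (C : category) (X Y : C) (e : X = Y) : hom X Y :=
  match e in _ = Z return hom X Z with erefl => idm X end.

(* The square          f'
                 P' ------> P
              p' |          | p
                 v          v
                 T ------> S
                       f                                                    *)
Definition cartesian (C : category) (P' P T S : C)
    (f' : hom P' P) (p' : hom P' T) (p : hom P S) (f : hom T S) : Prop :=
  p \c f' = f \c p' /\
  forall (X : C) (a : hom X P) (b : hom X T), p \c a = f \c b ->
    exists! c : hom X P', f' \c c = a /\ p' \c c = b.

Definition has_binary_products (C : category) : Prop :=
  forall X Y : C, exists (Q : C) (q1 : hom Q X) (q2 : hom Q Y),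
    forall (W : C) (a : hom W X) (b : hom W Y),
      exists! c : hom W Q, q1 \c c = a /\ q2 \c c = b.

Definition full_sub (C : category) (P : C -> Prop) : category := {|
  ob := {X : C | P X};
  hom := fun X Y => hom (sval X) (sval Y);
  idm := fun X => idm (sval X);
  mcomp := fun X Y Z g f => g \c f;
  mcomp_idl := fun X Y f => mcomp_idl f;
  mcomp_idr := fun X Y f => mcomp_idr f;
  mcompA := fun X Y Z W h g f => mcompA h g f
|}.

Record functor (C D : category) := Functor {
  fob :> C -> D;
  fmap : forall X Y, hom X Y -> hom (fob X) (fob Y);
  fmap_id : forall X, fmap (idm X) = idm (fob X);
  fmap_comp : forall X Y Z (g : hom Y Z) (f : hom X Y),
    fmap (g \c f) = fmap g \c fmap f
}.
Arguments fmap {C D} _ {X Y} _.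

Definition fid (C : category) : functor C C := {|
  fob := fun X => X;
  fmap := fun X Y f => f;
  fmap_id := fun X => erefl;
  fmap_comp := fun X Y Z g f => erefl
|}.

Section FunctorComp.
Variables (C D E : category) (G : functor D E) (F : functor C D).

Lemma fcomp_id X : fmap G (fmap F (idm X)) = idm (G (F X)).
Proof. by rewrite !fmap_id. Qed.

Lemma fcomp_comp X Y Z (g : hom Y Z) (f : hom X Y) :
  fmap G (fmap F (g \c f)) = fmap G (fmap F g) \c fmap G (fmap F f).
Proof. by rewrite !fmap_comp. Qed.

Definition fcomp : functor C E := {|
  fob := fun X => G (F X);
  fmap := fun X Y f => fmap G (fmap F f);
  fmap_id := fcomp_id;
  fmap_comp := fcomp_comp
|}.
End FunctorComp.

Section Product.
Variables C D : category.

Lemma pcat_idl (X Y : C * D) (f : hom X.1 Y.1 * hom X.2 Y.2) :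
  (idm Y.1 \c f.1, idm Y.2 \c f.2) = f.
Proof. by case: f => f1 f2; rewrite !mcomp_idl. Qed.

Lemma pcat_idr (X Y : C * D) (f : hom X.1 Y.1 * hom X.2 Y.2) :
  (f.1 \c idm X.1, f.2 \c idm X.2) = f.
Proof. by case: f => f1 f2; rewrite !mcomp_idr. Qed.

Lemma pcat_compA (X Y Z W : C * D) (h : hom Z.1 W.1 * hom Z.2 W.2)
    (g : hom Y.1 Z.1 * hom Y.2 Z.2) (f : hom X.1 Y.1 * hom X.2 Y.2) :
  (h.1 \c (g.1 \c f.1), h.2 \c (g.2 \c f.2)) =
  (h.1 \c g.1 \c f.1, h.2 \c g.2 \c f.2).
Proof. by rewrite !mcompA. Qed.

Definition prod_cat : category := {|
  ob := C * D;
  hom := fun X Y => (hom X.1 Y.1 * hom X.2 Y.2)%type;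
  idm := fun X => (idm X.1, idm X.2);
  mcomp := fun X Y Z g f => (g.1 \c f.1, g.2 \c f.2);
  mcomp_idl := pcat_idl;
  mcomp_idr := pcat_idr;
  mcompA := pcat_compA
|}.
End Product.

Section ProductFunctor.
Variables (C D C' D' : category) (F : functor C C') (G : functor D D').

Lemma fprod_id (X : prod_cat C D) :
  (fmap F (idm X).1, fmap G (idm X).2) = idm ((F X.1, G X.2) : prod_cat C' D').
Proof. by rewrite /= !fmap_id. Qed.

Lemma fprod_comp (X Y Z : prod_cat C D) (g : hom Y Z) (f : hom X Y) :
  (fmap F (g \c f).1, fmap G (g \c f).2) =
  ((fmap F g.1, fmap G g.2) : @hom (prod_cat C' D') (F Y.1, G Y.2) (F Z.1, G Z.2))
  \c ((fmap F f.1, fmap G f.2) : @hom (prod_cat C' D') (F X.1, G X.2) (F Y.1, G Y.2)).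
Proof. by rewrite /= !fmap_comp. Qed.

Definition fprod : functor (prod_cat C D) (prod_cat C' D') :=
  @Functor (prod_cat C D) (prod_cat C' D')
    (fun X => (F X.1, G X.2))
    (fun X Y f => (fmap F f.1, fmap G f.2))
    fprod_id fprod_comp.
End ProductFunctor.

Definition bmap (C D E : category) (F : functor (prod_cat C D) E)
    (A A' : C) (B B' : D) (f : hom A A') (g : hom B B') :
    hom (F (A, B)) (F (A', B')) :=
  @fmap _ _ F (A, B) (A', B') (f, g).

Record nattrans (C D : category) (F G : functor C D) := NatTrans {
  nt_app :> forall X, hom (F X) (G X);
  nt_nat : forall X Y (f : hom X Y), fmap G f \c nt_app X = nt_app Y \c fmap F f
}.

Record natiso (C D : category) (F G : functor C D) := NatIso {
  ni_nt :> nattrans F G;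
  ni_inv : forall X, hom (G X) (F X);
  ni_invl : forall X, ni_inv X \c ni_nt X = idm (F X);
  ni_invr : forall X, ni_nt X \c ni_inv X = idm (G X)
}.

(* [adjunction L R]: L is left adjoint to R. *)
Record adjunction (C D : category) (L : functor C D) (R : functor D C) := Adjunction {
  adj_unit : nattrans (fid C) (fcomp R L);
  adj_counit : nattrans (fcomp L R) (fid D);
  adj_tri1 : forall X, adj_counit (L X) \c fmap L (adj_unit X) = idm (L X);
  adj_tri2 : forall Y, fmap R (adj_counit Y) \c adj_unit (R Y) = idm (R Y)
}.

Definition has_left_adjoint (C D : category) (R : functor D C) : Prop :=
  exists L : functor C D, inhabited (adjunction L R).
Definition has_right_adjoint (C D : category) (L : functor C D) : Prop :=
  exists R : functor D C, inhabited (adjunction L R).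

Definition fully_faithful (C D : category) (F : functor C D) : Prop :=
  forall (X Y : C) (g : hom (F X) (F Y)), exists! f : hom X Y, fmap F f = g.
Definition ess_surjective (C D : category) (F : functor C D) : Prop :=
  forall Y : D, exists (X : C) (f : hom (F X) Y), is_iso f.

(* [zmodType] carries a choice structure on each Hom, which is no restriction
   classically. *)
Record preadditive := Preadditive {
  pob : Type;
  phom : pob -> pob -> zmodType;
  pidm : forall X, phom X X;
  pcomp : forall X Y Z, phom Y Z -> phom X Y -> phom X Z;
  pcomp_idl : forall X Y (f : phom X Y), pcomp (pidm Y) f = f;
  pcomp_idr : forall X Y (f : phom X Y), pcomp f (pidm X) = f;
  pcompA : forall X Y Z W (h : phom Z W) (g : phom Y Z) (f : phom X Y),
    pcomp h (pcomp g f) = pcomp (pcomp h g) f;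
  pcompDl : forall X Y Z (g g' : phom Y Z) (f : phom X Y),
    pcomp (g + g') f = pcomp g f + pcomp g' f;
  pcompDr : forall X Y Z (g : phom Y Z) (f f' : phom X Y),
    pcomp g (f + f') = pcomp g f + pcomp g f'
}.

Coercion preadditive_category (A : preadditive) : category := {|
  ob := pob A;
  hom := fun X Y => phom X Y;
  idm := @pidm A;
  mcomp := @pcomp A;
  mcomp_idl := @pcomp_idl A;
  mcomp_idr := @pcomp_idr A;
  mcompA := @pcompA A
|}.

Definition is_zero (A : preadditive) (X : A) : Prop := idm X = 0 :> phom X X.

Definition additive_functor (A B : preadditive) (F : functor A B) : Prop :=
  forall (X Y : A) (f g : phom X Y),
    fmap F (f + g : phom X Y) = (fmap F f : phom (F X) (F Y)) + fmap F g.

Definition has_biproducts (A : preadditive) : Prop :=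
  forall X Y : A, exists (B : A) (i1 : phom X B) (i2 : phom Y B)
    (p1 : phom B X) (p2 : phom B Y),
    [/\ pcomp p1 i1 = idm X, pcomp p2 i2 = idm Y, pcomp p1 i2 = 0, pcomp p2 i1 = 0
      & pcomp i1 p1 + pcomp i2 p2 = idm B].

(* The shift is an additive auto-equivalence (not necessarily a strict
   automorphism); [dist f g h] says that  X -f-> Y -g-> Z -h-> X[1]  is
   distinguished. *)
Record tricat := TriCat {
  tc_preadd :> preadditive;
  tc_zero : exists Z : tc_preadd, is_zero Z;
  tc_biprod : has_biproducts tc_preadd;
  shift : functor tc_preadd tc_preadd;
  shift_additive : additive_functor shift;
  shift_ff : fully_faithful shift;
  shift_es : ess_surjective shift;
  dist : forall X Y Z : tc_preadd,
    hom X Y -> hom Y Z -> hom Z (shift X) -> Prop;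
  dist_iso : forall (X Y Z X' Y' Z' : tc_preadd)
      (f : hom X Y) (g : hom Y Z) (h : hom Z (shift X))
      (f' : hom X' Y') (g' : hom Y' Z') (h' : hom Z' (shift X'))
      (a : hom X X') (b : hom Y Y') (c : hom Z Z'),
    is_iso a -> is_iso b -> is_iso c ->
    b \c f = f' \c a -> c \c g = g' \c b -> fmap shift a \c h = h' \c c ->
    dist f g h -> dist f' g' h';
  dist_id : forall X Z : tc_preadd, is_zero Z ->
    dist (idm X) (0 : phom X Z) (0 : phom Z (shift X));
  dist_cone : forall (X Y : tc_preadd) (f : hom X Y),
    exists (Z : tc_preadd) (g : hom Y Z) (h : hom Z (shift X)), dist f g h;
  dist_rot : forall (X Y Z : tc_preadd)
      (f : hom X Y) (g : hom Y Z) (h : hom Z (shift X)),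
    dist f g h <-> dist g h (- (fmap shift f : phom (shift X) (shift Y)));
  dist_map : forall (X Y Z X' Y' Z' : tc_preadd)
      (f : hom X Y) (g : hom Y Z) (h : hom Z (shift X))
      (f' : hom X' Y') (g' : hom Y' Z') (h' : hom Z' (shift X'))
      (a : hom X X') (b : hom Y Y'),
    dist f g h -> dist f' g' h' -> b \c f = f' \c a ->
    exists c : hom Z Z', c \c g = g' \c b /\ fmap shift a \c h = h' \c c;
  dist_oct : forall (X Y Z X' Y' Z' : tc_preadd)
      (f : hom X Y) (f1 : hom Y Z') (f2 : hom Z' (shift X))
      (g : hom Y Z) (g1 : hom Z X') (g2 : hom X' (shift Y))
      (k1 : hom Z Y') (k2 : hom Y' (shift X)),
    dist f f1 f2 -> dist g g1 g2 -> dist (g \c f) k1 k2 ->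
    exists (u : hom Z' Y') (v : hom Y' X'),
      [/\ dist u v (fmap shift f1 \c g2),
          u \c f1 = k1 \c g, k2 \c u = f2,
          v \c k1 = g1 & g2 \c v = fmap shift f \c k2]
}.
Arguments shift {t}.

(* The commutation of a functor with the shifts is part of the data of a
   triangulated functor. *)
Definition shift_family (C D : tricat) (F : functor C D) :=
  forall X : C, hom (F (shift X)) (shift (F X)).

Record triangulated (C D : tricat) (F : functor C D) (s : shift_family F) : Prop :=
  Triangulated {
  tri_additive : additive_functor F;
  tri_nat : forall (X Y : C) (f : hom X Y),
    fmap shift (fmap F f) \c s X = s Y \c fmap F (fmap shift f);
  tri_iso : forall X, is_iso (s X);
  tri_dist : forall (X Y Z : C) (f : hom X Y) (g : hom Y Z) (h : hom Z (shift X)),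
    dist f g h -> dist (fmap F f) (fmap F g) (s X \c fmap F h)
}.

Definition shift_comp (C D E : tricat) (G : functor D E) (F : functor C D)
    (sG : shift_family G) (sF : shift_family F) : shift_family (fcomp G F) :=
  fun X => sG (F X) \c fmap G (sF X).

Definition tri_morphism (C D : tricat) (F G : functor C D)
    (sF : shift_family F) (sG : shift_family G) (a : nattrans F G) : Prop :=
  forall X : C, fmap shift (a X) \c sF X = sG X \c a (shift X).

Record bishift_family (C D E : tricat) (F : functor (prod_cat C D) E) := BiShift {
  bsl : forall (A : C) (B : D), hom (F (shift A, B)) (shift (F (A, B)));
  bsr : forall (A : C) (B : D), hom (F (A, shift B)) (shift (F (A, B)))
}.

(* [bitri_anti] is the usual sign rule: the two ways of extracting both shifts
   from F(A[1], B[1]) differ by -1. *)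
Record bitriangulated (C D E : tricat) (F : functor (prod_cat C D) E)
    (s : bishift_family F) : Prop := BiTriangulated {
  bitri_addl : forall (A A' : C) (B : D) (f f' : phom A A'),
    bmap F (f + f' : phom A A') (idm B) =
    (bmap F f (idm B) : phom (F (A, B)) (F (A', B))) + bmap F f' (idm B);
  bitri_addr : forall (A : C) (B B' : D) (g g' : phom B B'),
    bmap F (idm A) (g + g' : phom B B') =
    (bmap F (idm A) g : phom (F (A, B)) (F (A, B'))) + bmap F (idm A) g';
  bitri_natl : forall (A A' : C) (B B' : D) (f : hom A A') (g : hom B B'),
    fmap shift (bmap F f g) \c bsl s A B = bsl s A' B' \c bmap F (fmap shift f) g;
  bitri_natr : forall (A A' : C) (B B' : D) (f : hom A A') (g : hom B B'),
    fmap shift (bmap F f g) \c bsr s A B = bsr s A' B' \c bmap F f (fmap shift g);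
  bitri_isol : forall A B, is_iso (bsl s A B);
  bitri_isor : forall A B, is_iso (bsr s A B);
  bitri_anti : forall (A : C) (B : D),
    fmap shift (bsr s A B) \c bsl s A (shift B) =
    - (fmap shift (bsl s A B) \c bsr s (shift A) B
       : phom (F (shift A, shift B)) (shift (shift (F (A, B)))));
  bitri_distl : forall (X Y Z : C) (B : D)
      (f : hom X Y) (g : hom Y Z) (h : hom Z (shift X)), dist f g h ->
    dist (bmap F f (idm B)) (bmap F g (idm B)) (bsl s X B \c bmap F h (idm B));
  bitri_distr : forall (A : C) (X Y Z : D)
      (f : hom X Y) (g : hom Y Z) (h : hom Z (shift X)), dist f g h ->
    dist (bmap F (idm A) f) (bmap F (idm A) g) (bsr s A X \c bmap F (idm A) h)
}.

Definition bishift_pre (C D C' D' E : tricat)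
    (F : functor (prod_cat C' D') E) (G : functor C C') (K : functor D D')
    (sF : bishift_family F) (sG : shift_family G) (sK : shift_family K) :
    bishift_family (fcomp F (fprod G K)) := {|
  bsl := (fun A B => bsl sF (G A) (K B) \c bmap F (sG A) (idm (K B)))
    : forall A B, hom (fcomp F (fprod G K) (shift A, B))
                      (shift (fcomp F (fprod G K) (A, B)));
  bsr := (fun A B => bsr sF (G A) (K B) \c bmap F (idm (G A)) (sK B))
    : forall A B, hom (fcomp F (fprod G K) (A, shift B))
                      (shift (fcomp F (fprod G K) (A, B)))
|}.

Definition bishift_post (C D E E' : tricat)
    (G : functor E E') (F : functor (prod_cat C D) E)
    (sG : shift_family G) (sF : bishift_family F) :
    bishift_family (fcomp G F) := {|
  bsl := (fun A B => sG (F (A, B)) \c fmap G (bsl sF A B))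
    : forall A B, hom (fcomp G F (shift A, B)) (shift (fcomp G F (A, B)));
  bsr := (fun A B => sG (F (A, B)) \c fmap G (bsr sF A B))
    : forall A B, hom (fcomp G F (A, shift B)) (shift (fcomp G F (A, B)))
|}.

Definition bitri_morphism (C D E : tricat) (F G : functor (prod_cat C D) E)
    (sF : bishift_family F) (sG : bishift_family G) (a : nattrans F G) : Prop :=
  forall (A : C) (B : D),
    fmap shift (a (A, B)) \c bsl sF A B = bsl sG A B \c a (shift A, B) /\
    fmap shift (a (A, B)) \c bsr sF A B = bsr sG A B \c a (A, shift B).

Record base := Base {
  base_cat :> category;
  base_prod : has_binary_products base_cat;
  pt : base_cat;
  to_pt : forall X : base_cat, hom X pt;
  to_pt_uniq : forall (X : base_cat) (f : hom X pt), f = to_pt X;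
  smooth : forall X Y : base_cat, hom X Y -> Prop;
  closed_imm : forall X Y : base_cat, hom X Y -> Prop;
  smooth_iso : forall (X Y : base_cat) (f : hom X Y), is_iso f -> smooth f;
  smooth_comp : forall (X Y Z : base_cat) (g : hom Y Z) (f : hom X Y),
    smooth g -> smooth f -> smooth (g \c f);
  closed_iso : forall (X Y : base_cat) (f : hom X Y), is_iso f -> closed_imm f;
  closed_comp : forall (X Y Z : base_cat) (g : hom Y Z) (f : hom X Y),
    closed_imm g -> closed_imm f -> closed_imm (g \c f);
  smooth_pb_ex : forall (P T S : base_cat) (p : hom P S) (f : hom T S), smooth p ->
    exists (P' : base_cat) (f' : hom P' P) (p' : hom P' T), cartesian f' p' p f;
  smooth_pb : forall (P' P T S : base_cat)
      (f' : hom P' P) (p' : hom P' T) (p : hom P S) (f : hom T S),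
    cartesian f' p' p f -> smooth p -> smooth p';
  closed_pb : forall (Q P Z S : base_cat)
      (z' : hom Q P) (p' : hom Q Z) (p : hom P S) (z : hom Z S),
    cartesian z' p' p z -> smooth p -> closed_imm z -> closed_imm z';
  closed_cancel : forall (Z S V : base_cat) (z : hom Z S) (g : hom S V),
    closed_imm (g \c z) -> closed_imm z;
  closed_smooth_fact : forall (T S : base_cat) (f : hom T S),
    exists (P : base_cat) (t : hom T P) (p : hom P S),
      [/\ closed_imm t, smooth p & f = p \c t];
  empty : base_cat;
  from_empty : forall X : base_cat, hom empty X;
  from_empty_uniq : forall (X : base_cat) (f : hom empty X), f = from_empty X;
  compl : forall (Z S : base_cat) (z : hom Z S), closed_imm z -> base_cat;
  compl_imm : forall (Z S : base_cat) (z : hom Z S) (hz : closed_imm z),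
    hom (compl hz) S;
  compl_smooth : forall (Z S : base_cat) (z : hom Z S) (hz : closed_imm z),
    smooth (compl_imm hz);
  compl_inj : forall (Z S : base_cat) (z : hom Z S) (hz : closed_imm z)
      (T : base_cat) (g g' : hom T (compl hz)),
    compl_imm hz \c g = compl_imm hz \c g' -> g = g';
  compl_image : forall (Z S : base_cat) (z : hom Z S) (hz : closed_imm z)
      (T : base_cat) (f : hom T S),
    (exists g : hom T (compl hz), compl_imm hz \c g = f) <->
    cartesian (from_empty T) (from_empty Z) f z;
  (* [Z r] stands for Z_{r-1}. *)
  base_strat : forall S : base_cat, exists (n : nat) (Z : nat -> base_cat),
    [/\ Z 0%N = empty, Z n.+1 = S
      & forall r : nat, (r <= n)%N ->
          exists (z : hom (Z r) (Z r.+1)) (hz : closed_imm z), smooth (to_pt (compl hz))]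
}.

Definition in_U (S : base) (Y : S) : Prop := smooth (to_pt Y).
Definition Ucat (S : base) : category := full_sub (@in_U S).
Definition Usmooth (S : base) (X Y : Ucat S) (f : hom X Y) : Prop :=
  @smooth S (sval X) (sval Y) f.

(* The two isomorphisms (hgf)^* -> f^* g^* h^* have sources indexed by the two
   bracketings of hgf, whence [eq_hom] in [conn_assoc]. *)
Record fibered (C : category) (fib : C -> category) := Fibered {
  pull : forall T S : C, hom T S -> functor (fib S) (fib T);
  conn : forall (T S V : C) (f : hom T S) (g : hom S V),
    natiso (pull (g \c f)) (fcomp (pull f) (pull g));
  pull_id : forall S : C, pull (idm S) = fid (fib S);
  conn_assoc : forall (T S V W : C) (f : hom T S) (g : hom S V) (h : hom V W)
      (A : fib W),
    fmap (pull f) (conn g h A) \c conn f (h \c g) A =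
    conn f g (pull h A) \c conn (g \c f) h A
      \c eq_hom (f_equal (fun k => pull k A) (esym (mcompA h g f)))
}.

Record tri_fibered (C : category) := TriFibered {
  tfib : C -> tricat;
  tf_fibered :> fibered (fun S => tfib S : category);
  pull_shift : forall (T S : C) (f : hom T S),
    @shift_family (tfib S) (tfib T) (pull tf_fibered f);
  pull_tri : forall (T S : C) (f : hom T S), triangulated (pull_shift f);
  conn_tri : forall (T S V : C) (f : hom T S) (g : hom S V),
    tri_morphism (pull_shift (g \c f)) (shift_comp (pull_shift f) (pull_shift g))
                 (conn tf_fibered f g)
}.

Arguments pull_shift {C} t {T S} f.
Arguments pull_tri {C} t {T S} f.
Arguments conn_tri {C} t {T S V} f g A : rename.

Definition restrict_fibered (C : category) (P : C -> Prop) (fib : C -> category)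
    (H : fibered fib) : @fibered (full_sub P) (fun S => fib (sval S)) :=
  @Fibered (full_sub P) (fun S => fib (sval S))
    (fun T S f => pull H f)
    (fun T S V f g => conn H f g)
    (fun S => pull_id H (sval S))
    (fun T S V W f g h A => conn_assoc H f g h A).

Definition restrict_tri (C : category) (P : C -> Prop) (H : tri_fibered C) :
    tri_fibered (full_sub P) :=
  @TriFibered (full_sub P) (fun S => tfib H (sval S))
    (restrict_fibered P H)
    (fun T S f => pull_shift H f)
    (fun T S f => pull_tri H f)
    (fun T S V f g => conn_tri H f g).

Definition restrictU (S : base) (H : tri_fibered S) : tri_fibered (Ucat S) :=
  restrict_tri (@in_U S) H.

Section Localic.
Variables (S : base) (H : tri_fibered S).

(* f'^* p^* = (p f')^* = (f p')^* = p'^* f^* *)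
Definition square_swap (P' P T B : S)
    (f' : hom P' P) (p' : hom P' T) (p : hom P B) (f : hom T B)
    (e : p \c f' = f \c p') (A : tfib H B) :
    @hom (tfib H P') (pull H f' (pull H p A)) (pull H p' (pull H f A)) :=
  conn H p' f A
    \c eq_hom (f_equal (fun k => pull H k A : ob (tfib H P')) e)
    \c ni_inv (conn H f' p) A.

Definition base_change (P' P T B : S)
    (f' : hom P' P) (p' : hom P' T) (p : hom P B) (f : hom T B)
    (e : p \c f' = f \c p')
    (L : functor (tfib H P) (tfib H B)) (adj : adjunction L (pull H p))
    (L' : functor (tfib H P') (tfib H T)) (adj' : adjunction L' (pull H p'))
    (A : tfib H P) :
    hom (L' (pull H f' A)) (pull H f (L A)) :=
  adj_counit adj' (pull H f (L A))
    \c fmap L' (square_swap e (L A))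
    \c fmap L' (fmap (pull H f') (adj_unit adj A)).

(* Adjoints being unique up to unique isomorphism, the conditions on p_# and
   z_* are imposed on all adjoints. *)
Record localic : Prop := Localic {
  loc_empty : forall A : tfib H (empty S), is_zero A;
  loc_sharp : forall (P B : S) (p : hom P B), smooth p ->
    has_left_adjoint (pull H p);
  loc_base_change : forall (P' P T B : S)
      (f' : hom P' P) (p' : hom P' T) (p : hom P B) (f : hom T B)
      (c : cartesian f' p' p f), smooth p ->
    forall (L : functor (tfib H P) (tfib H B)) (adj : adjunction L (pull H p))
      (L' : functor (tfib H P') (tfib H T)) (adj' : adjunction L' (pull H p'))
      (A : tfib H P), is_iso (base_change (proj1 c) adj adj' A);
  loc_star : forall (Z B : S) (z : hom Z B), closed_imm z ->
    has_right_adjoint (pull H z);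
  loc_star_ff : forall (Z B : S) (z : hom Z B), closed_imm z ->
    forall R : functor (tfib H Z) (tfib H B), adjunction (pull H z) R ->
      fully_faithful R;
  loc_conservative : forall (Z B : S) (z : hom Z B) (hz : closed_imm z)
      (A A' : tfib H B) (a : hom A A'),
    is_iso (fmap (pull H z) a) -> is_iso (fmap (pull H (compl_imm hz)) a) ->
    is_iso a
}.
End Localic.

Record tensor (C : category) (fib : C -> category) (H : fibered fib) := Tensor {
  tens : forall S : C, functor (prod_cat (fib S) (fib S)) (fib S);
  tens_m : forall (T S : C) (f : hom T S),
    natiso (fcomp (tens T) (fprod (pull H f) (pull H f))) (fcomp (pull H f) (tens S));
  tens_m_comp : forall (T S V : C) (f : hom T S) (g : hom S V) (A B : fib V),
    conn H f g (tens V (A, B)) \c tens_m (g \c f) (A, B) =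
    fmap (pull H f) (tens_m g (A, B))
      \c tens_m f (pull H g A, pull H g B)
      \c bmap (tens T) (conn H f g A) (conn H f g B)
}.

Record tri_tensor (C : category) (H : tri_fibered C) := TriTensor {
  tt_tensor :> tensor H;
  tt_shift : forall S : C,
    @bishift_family (tfib H S) (tfib H S) (tfib H S) (tens tt_tensor S);
  tt_bitri : forall S : C, bitriangulated (tt_shift S);
  tt_m_bitri : forall (T S : C) (f : hom T S),
    bitri_morphism
      (bishift_pre (tt_shift T) (pull_shift H f) (pull_shift H f))
      (bishift_post (pull_shift H f) (tt_shift S))
      (tens_m tt_tensor f)
}.

Section LocalicTensor.
Variables (C : category) (fib : C -> category) (H : fibered fib) (t : tensor H).
Variables (P S : C) (p : hom P S).
Variables (L : functor (fib P) (fib S)) (adj : adjunction L (pull H p)).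

Definition proj_formula_l (A : fib P) (B : fib S) :
    hom (L (tens t P (A, pull H p B))) (tens t S (L A, B)) :=
  adj_counit adj (tens t S (L A, B))
    \c fmap L (tens_m t p (L A, B))
    \c fmap L (bmap (tens t P) (adj_unit adj A) (idm (pull H p B))).

Definition proj_formula_r (A : fib S) (B : fib P) :
    hom (L (tens t P (pull H p A, B))) (tens t S (A, L B)) :=
  adj_counit adj (tens t S (A, L B))
    \c fmap L (tens_m t p (A, L B))
    \c fmap L (bmap (tens t P) (idm (pull H p A)) (adj_unit adj B)).
End LocalicTensor.

Definition localic_tensor (C : category) (sm : forall X Y : C, hom X Y -> Prop)
    (H : tri_fibered C) (t : tri_tensor H) : Prop :=
  forall (P S : C) (p : hom P S), sm P S p ->
  forall (L : functor (tfib H P) (tfib H S)) (adj : adjunction L (pull H p)),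
    (forall A B, is_iso (proj_formula_l t adj A B)) /\
    (forall A B, is_iso (proj_formula_r t adj A B)).

Record tensor_equiv (C : category) (fib : C -> category) (H : fibered fib)
    (t t' : tensor H) := TensorEquiv {
  te_iso : forall S : C, natiso (tens t S) (tens t' S);
  te_compat : forall (T S : C) (f : hom T S) (A B : fib S),
    tens_m t' f (A, B) \c te_iso T (pull H f A, pull H f B) =
    fmap (pull H f) (te_iso S (A, B)) \c tens_m t f (A, B)
}.

Section IdEquiv.
Variables (C : category) (fib : C -> category) (H : fibered fib) (t : tensor H).

Lemma id_nat (D E : category) (F : functor D E) X Y (f : hom X Y) :
  fmap F f \c idm (F X) = idm (F Y) \c fmap F f.
Proof. by rewrite mcomp_idl mcomp_idr. Qed.

Definition natiso_id (D E : category) (F : functor D E) : natiso F F :=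
  @NatIso D E F F (NatTrans (@id_nat D E F)) (fun X => idm (F X))
    (fun X => mcomp_idl (idm (F X))) (fun X => mcomp_idl (idm (F X))).

Lemma id_compat (T S : C) (f : hom T S) (A B : fib S) :
  tens_m t f (A, B) \c natiso_id (tens t T) (pull H f A, pull H f B) =
  fmap (pull H f) (natiso_id (tens t S) (A, B)) \c tens_m t f (A, B).
Proof. by rewrite /= fmap_id mcomp_idl mcomp_idr. Qed.

Definition tensor_equiv_id : tensor_equiv t t :=
  @TensorEquiv C fib H t t (fun S => natiso_id (tens t S)) id_compat.
End IdEquiv.

Definition tensor_equiv_of_eq (C : category) (H : tri_fibered C) (t t' : tri_tensor H)
    (e : t = t') : tensor_equiv t t' :=
  match e in _ = t0 return tensor_equiv t t0 with
  | erefl => tensor_equiv_id t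
  end.

Section Restriction.
Variables (S : base) (H : tri_fibered S).

Definition restrict_tensor (t : tensor H) : tensor (restrictU H) :=
  @Tensor (Ucat S) (fun X => tfib H (sval X)) (restrictU H)
    (fun X => tens t (sval X))
    (fun Y X f => tens_m t f)
    (fun Y X V f g A B => tens_m_comp t f g A B).

Definition restrict_tri_tensor (t : tri_tensor H) : tri_tensor (restrictU H) :=
  @TriTensor (Ucat S) (restrictU H)
    (restrict_tensor t)
    (fun X => tt_shift t (sval X))
    (fun X => tt_bitri t (sval X))
    (fun Y X f => tt_m_bitri t f).

Definition restrict_equiv (t t' : tri_tensor H) (e : tensor_equiv t t') :
    tensor_equiv (restrict_tri_tensor t) (restrict_tri_tensor t') :=
  @TensorEquiv (Ucat S) (fun X => tfib H (sval X)) (restrictU H)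
    (restrict_tri_tensor t) (restrict_tri_tensor t')
    (fun X => te_iso e (sval X))
    (fun Y X f A B => te_compat e f A B).
End Restriction.

(* Main.v *)
(* Let s : X -> Y be a closed immersion with Y in U and open complement u.  By
   localization the kernel of s^* consists of the objects u_# D, and the projection
   formula makes it a tensor ideal.  Hence s^*(A (x) B) depends only on s^* A and
   s^* B, and the tensor product of A and B in H(X) has to be s^*(s_* A (x) s_* B).

   As s^* s_* = id, a natural transformation of functors on H(X) is determined by
   its values on objects pulled back from U; conversely, coherent values on the
   pullbacks along all arrows g : X -> V with V in U come from a natural
   transformation, because s and g both factor through the closed immersion
   (s, g) : X -> Y x V.  This single principle yields the isomorphisms m_f for
   arbitrary f, the shift isomorphisms, the comparison with any other extension, and
   all the identities between them.

   Projection formulas commute with base change, so by conservativity they can be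
   checked on the strata of a stratification, which lie in U. *)
Require Import Defs.
From mathcomp Require Import all_boot ssralg.
From Stdlib Require Import ClassicalEpsilon FunctionalExtensionality ProofIrrelevance.

Set Implicit Arguments.
Unset Strict Implicit.
Unset Printing Implicit Defensive.

Import GRing.Theory.
Local Open Scope ring_scope.
Local Open Scope cat_scope.

(** * Categories and adjunctions *)

(** That the kernel of s^* is a tensor ideal is a statement about objects; the construction needs
    one about morphisms: if s^* inverts x and y, then it inverts x (x) y. Cones lead from the first
    to the second, and this is where exactness of the tensor product over U enters. The next
    obstacle is that data on pullbacks g^* A are natural only for morphisms pulled back from V,
    while a morphism g^* A -> g^* B of H(X) need not be of that kind. The functor s_* lifts every
    morphism of H(X), and different g are compared through morphisms of H(Q), with Q in U, that q^*
    inverts. Of s_* only functoriality, the adjunction and the invertibility of its counit are used.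
    Additivity and exactness of s_* never enter: sums and cones are formed in H(V) and then pulled
    back. The extensions at distinct objects are chosen independently, all compatibilities between
    them being consequences of the universal property; this freedom is what allows [t] itself to be
    chosen over U. *)

Section CategoryTheory.
Variable C : category.

(** Long composites are kept associated to the right; this form applies an identity between two-term
    composites at the head of a longer one. *)
Lemma reassoc (X Y Y' Z : C) (a : hom Y Z) (b : hom X Y) (c : hom Y' Z) (d : hom X Y') :
  a \c b = c \c d -> forall W (r : hom W X), a \c (b \c r) = c \c (d \c r).
Proof. by move=> e W r; rewrite !mcompA e. Qed.

Lemma reassoc1 (X Y Z : C) (a : hom Y Z) (b : hom X Y) (c : hom X Z) :
  a \c b = c -> forall W (r : hom W X), a \c (b \c r) = c \c r.
Proof. by move=> e W r; rewrite !mcompA e. Qed.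

Lemma is_iso_id (X : C) : is_iso (idm X).
Proof. by exists (idm X); rewrite mcomp_idl. Qed.

Lemma is_iso_comp (X Y Z : C) (g : hom Y Z) (f : hom X Y) :
  is_iso g -> is_iso f -> is_iso (g \c f).
Proof.
move=> [g' [g1 g2]] [f' [f1 f2]]; exists (f' \c g'); split.
  by rewrite -mcompA (reassoc1 g1) mcomp_idl.
by rewrite -mcompA (reassoc1 f2) mcomp_idl.
Qed.

Definition iso_inv (X Y : C) (f : hom X Y) (h : is_iso f) : hom Y X :=
  proj1_sig (constructive_indefinite_description _ h).

Lemma iso_invl (X Y : C) (f : hom X Y) (h : is_iso f) : iso_inv h \c f = idm X.
Proof. by rewrite /iso_inv; case: constructive_indefinite_description => g []. Qed.

Lemma iso_invr (X Y : C) (f : hom X Y) (h : is_iso f) : f \c iso_inv h = idm Y.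
Proof. by rewrite /iso_inv; case: constructive_indefinite_description => g []. Qed.

Lemma iso_inv_iso (X Y : C) (f : hom X Y) (h : is_iso f) : is_iso (iso_inv h).
Proof. by exists f; rewrite iso_invl iso_invr. Qed.

Lemma iso_mono (X Y Z : C) (g : hom Y Z) (f f' : hom X Y) :
  is_iso g -> g \c f = g \c f' -> f = f'.
Proof.
by move=> [g' [g1 _]] e; rewrite -(mcomp_idl f) -g1 -mcompA e mcompA g1 mcomp_idl.
Qed.

Lemma iso_epi (X Y Z : C) (g : hom X Y) (f f' : hom Y Z) :
  is_iso g -> f \c g = f' \c g -> f = f'.
Proof.
by move=> [g' [_ g1]] e; rewrite -(mcomp_idr f) -g1 mcompA e -mcompA g1 mcomp_idr.
Qed.

Lemma is_iso_cancel_l (X Y Z : C) (g : hom Y Z) (f : hom X Y) :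
  is_iso g -> is_iso (g \c f) -> is_iso f.
Proof.
move=> ig; move: (ig) => [g' [g1 g2]] [k [k1 k2]]; exists (k \c g); split.
  by rewrite -mcompA.
by apply: (iso_mono ig); rewrite !mcompA k2 mcomp_idl mcomp_idr.
Qed.

Lemma is_iso_cancel_r (X Y Z : C) (g : hom Y Z) (f : hom X Y) :
  is_iso f -> is_iso (g \c f) -> is_iso g.
Proof.
move=> if_ [k [k1 k2]]; exists (f \c k); split; last by rewrite mcompA.
by apply: (iso_epi if_); rewrite -!mcompA k1 mcomp_idl mcomp_idr.
Qed.

Lemma is_iso_inv (X Y : C) (f : hom X Y) (g : hom Y X) :
  g \c f = idm X -> is_iso f -> is_iso g.
Proof. by move=> e i; apply: (is_iso_cancel_r i); rewrite e; apply: is_iso_id. Qed.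

End CategoryTheory.

Lemma fmap_iso (C D : category) (F : functor C D) (X Y : C) (f : hom X Y) :
  is_iso f -> is_iso (fmap F f).
Proof. by move=> [g [g1 g2]]; exists (fmap F g); rewrite -!fmap_comp g1 g2 !fmap_id. Qed.

Lemma natiso_iso (C D : category) (F G : functor C D) (a : natiso F G) X : is_iso (a X).
Proof. by exists (ni_inv a X); rewrite ni_invl ni_invr. Qed.

Section Bifunctor.
Variables (C D E : category) (F : functor (prod_cat C D) E).

Lemma bmap_comp (A A' A'' : C) (B B' B'' : D) (f : hom A A') (f' : hom A' A'')
    (g : hom B B') (g' : hom B' B'') :
  bmap F f' g' \c bmap F f g = bmap F (f' \c f) (g' \c g).
Proof. by rewrite /bmap -(@fmap_comp _ _ F (A, B) (A', B') (A'', B'')). Qed.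

Lemma bmap_id (A : C) (B : D) : bmap F (idm A) (idm B) = idm (F (A, B)).
Proof. exact: (@fmap_id _ _ F (A, B)). Qed.

Lemma bmap_iso (A A' : C) (B B' : D) (f : hom A A') (g : hom B B') :
  is_iso f -> is_iso g -> is_iso (bmap F f g).
Proof.
move=> [f' [f1 f2]] [g' [g1 g2]]; exists (bmap F f' g').
by rewrite !bmap_comp f1 f2 g1 g2 !bmap_id.
Qed.

End Bifunctor.

Section BmapPre.
Variables (C D C' D' E : category) (F : functor (prod_cat C' D') E).
Variables (G : functor C C') (K : functor D D').
Variables (A A' : C) (B B' : D) (x : hom A A') (y : hom B B').
Let P := fcomp F (Defs.fprod G K).

(* [bmap P x y] has the same endpoints as the right-hand side only up to
   conversion; rewriting a whole composite also normalizes the middle object. *)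
Lemma bmap_prel (W : E) (r : hom W (F (G A, K B))) :
  @mcomp E W (P (A, B)) (P (A', B')) (bmap P x y) r =
  (bmap F (fmap G x) (fmap K y) : hom _ (F (G A', K B'))) \c r.
Proof. by []. Qed.

End BmapPre.

Section Adjunction.
Variables (C D : category) (L : functor C D) (R : functor D C) (adj : adjunction L R).

Definition transpose (X : C) (Y : D) (x : hom (L X) Y) : hom X (R Y) :=
  fmap R x \c adj_unit adj X.

Lemma counit_transpose X Y (x : hom (L X) Y) :
  adj_counit adj Y \c fmap L (transpose x) = x.
Proof.
rewrite /transpose fmap_comp mcompA.
rewrite -(nt_nat (adj_counit adj) x) /= -mcompA.
by rewrite adj_tri1 mcomp_idr.
Qed.

Lemma transpose_inj X Y (x y : hom (L X) Y) : transpose x = transpose y -> x = y.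
Proof. by move=> e; rewrite -(counit_transpose x) e counit_transpose. Qed.

Lemma transpose_counit X Y (x : hom X (R Y)) :
  transpose (adj_counit adj Y \c fmap L x) = x.
Proof.
rewrite /transpose fmap_comp -mcompA (nt_nat (adj_unit adj) x) mcompA.
by rewrite adj_tri2 mcomp_idl.
Qed.

Lemma transpose_compl X Y Y' (a : hom Y Y') (x : hom (L X) Y) :
  transpose (a \c x) = fmap R a \c transpose x.
Proof. by rewrite /transpose fmap_comp mcompA. Qed.

Lemma transpose_compr X X' Y (x : hom (L X) Y) (c : hom X' X) :
  transpose (x \c fmap L c) = transpose x \c c.
Proof. by rewrite /transpose fmap_comp -!mcompA (nt_nat (adj_unit adj) c). Qed.

Lemma counit_nat Y Y' (a : hom Y Y') :
  a \c adj_counit adj Y = adj_counit adj Y' \c fmap L (fmap R a).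
Proof. exact: (nt_nat (adj_counit adj) a). Qed.

Hypothesis ff : fully_faithful R.

Lemma ff_inj Y Y' (x y : hom Y Y') : fmap R x = fmap R y -> x = y.
Proof. by move=> e; have [z [_ u]] := ff (fmap R y); rewrite -(u _ e) (u y). Qed.

(** The inverse is the preimage under [R] of the unit at [R Y]. *)
Lemma ff_counit_iso Y : is_iso (adj_counit adj Y).
Proof.
have [k [ek _]] := ff (adj_unit adj (R Y)).
exists k; split; last first.
  by apply: ff_inj; rewrite fmap_comp ek adj_tri2 fmap_id.
apply: transpose_inj; rewrite /transpose fmap_comp -mcompA adj_tri2 mcomp_idr ek.
by rewrite fmap_id mcomp_idl.
Qed.

Lemma ff_unit_iso X : is_iso (fmap L (adj_unit adj X)).
Proof.
by apply: (is_iso_cancel_l (ff_counit_iso (L X))); rewrite adj_tri1; apply: is_iso_id.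
Qed.

End Adjunction.

Section Preadditive.
Variable A : preadditive.

Lemma comp0l (X Y Z : A) (f : hom X Y) : ((0 : phom Y Z) : hom Y Z) \c f = 0 :> phom X Z.
Proof. by apply: (@addrI _ (((0 : phom Y Z) : hom Y Z) \c f : phom X Z)); rewrite -pcompDl !addr0. Qed.

Lemma comp0r (X Y Z : A) (f : hom Y Z) : f \c ((0 : phom X Y) : hom X Y) = 0 :> phom X Z.
Proof. by apply: (@addrI _ (f \c ((0 : phom X Y) : hom X Y) : phom X Z)); rewrite -pcompDr !addr0. Qed.

Lemma compDl (X Y Z : A) (g g' : hom Y Z) (f : hom X Y) :
  (((g : phom Y Z) + (g' : phom Y Z)) : hom Y Z) \c f =
  (g \c f : phom X Z) + (g' \c f : phom X Z).
Proof. exact: pcompDl. Qed.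

Lemma compDr (X Y Z : A) (g : hom Y Z) (f f' : hom X Y) :
  g \c (((f : phom X Y) + (f' : phom X Y)) : hom X Y) =
  (g \c f : phom X Z) + (g \c f' : phom X Z).
Proof. exact: pcompDr. Qed.

Lemma compNl (X Y Z : A) (g : hom Y Z) (f : hom X Y) :
  ((- (g : phom Y Z) : phom Y Z) : hom Y Z) \c f = - (g \c f : phom X Z).
Proof. by apply/eqP; rewrite -subr_eq0 opprK -pcompDl addNr; apply/eqP; apply: comp0l. Qed.

Lemma compNr (X Y Z : A) (g : hom Y Z) (f : hom X Y) :
  g \c ((- (f : phom X Y) : phom X Y) : hom X Y) = - (g \c f : phom X Z).
Proof. by apply/eqP; rewrite -subr_eq0 opprK -pcompDr addNr; apply/eqP; apply: comp0r. Qed.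

Lemma zero_dom (X Y : A) (f : phom X Y) : is_zero X -> f = 0.
Proof. by move=> z; rewrite -[f]pcomp_idr; move: z; rewrite /is_zero /= => ->; exact: comp0r. Qed.

Lemma zero_cod (X Y : A) (f : phom X Y) : is_zero Y -> f = 0.
Proof. by move=> z; rewrite -[f]pcomp_idl; move: z; rewrite /is_zero /= => ->; exact: comp0l. Qed.

Lemma zero_iso (X Y : A) (f : hom X Y) : is_zero X -> is_zero Y -> is_iso f.
Proof.
move=> zX zY; exists (0 : phom Y X); split.
  by rewrite comp0l; symmetry; apply: zX.
by rewrite comp0r; symmetry; apply: zY.
Qed.

Lemma is_zero_iso (X Y : A) (f : hom X Y) : is_iso f -> is_zero X -> is_zero Y.
Proof.
move=> [g [_ e]] z; rewrite /is_zero -e.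
by rewrite (_ : f = (0 : phom X Y)) ?comp0l //; apply: zero_dom.
Qed.

End Preadditive.

Section Additive.
Variables (A B : preadditive) (F : functor A B) (aF : additive_functor F).

Lemma fmap0 (X Y : A) : fmap F (0 : phom X Y) = 0 :> phom (F X) (F Y).
Proof.
by apply: (@addrI _ (fmap F (0 : phom X Y) : phom (F X) (F Y))); rewrite -aF !addr0.
Qed.

Lemma fmapN (X Y : A) (f : phom X Y) :
  fmap F (- f : phom X Y) = - (fmap F f : phom (F X) (F Y)).
Proof. by apply/eqP; rewrite -subr_eq0 opprK -aF addNr fmap0. Qed.

End Additive.

(** * Triangulated categories *)

Section Triangles.
Variable C : tricat.
Implicit Types X Y Z : C.

(** Comparison with the triangle X = X -> 0 makes [g \c f] factor through a zero object. *)
Lemma dist_comp0 X Y Z (f : hom X Y) (g : hom Y Z) (h : hom Z (shift X)) :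
  dist f g h -> g \c f = 0 :> phom X Z.
Proof.
move=> d; have [O zO] := tc_zero C.
have [|c [e _]] := @dist_map C _ _ _ _ _ _ _ _ _ _ _ _ (idm X) f (dist_id X zO) d.
  by [].
by rewrite -e comp0r.
Qed.

Lemma shift_inj X Y (x y : hom X Y) : fmap shift x = fmap shift y -> x = y.
Proof. exact: (ff_inj (@shift_ff C)). Qed.

(** [dist_map] only completes the third component, so both triangles are rotated until the wanted
    lift is the third one. It appears as W[1] -> X[1], with two signs that cancel, and comes from W
    -> X because the shift is fully faithful. *)
Lemma dist_ker X Y Z (f : hom X Y) (g : hom Y Z) (h : hom Z (shift X)) :
  dist f g h -> forall (W : C) (x : hom W Y), g \c x = 0 :> phom W Z ->
  exists y : hom W X, x = f \c y.
Proof.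
move=> d W x gx0; have [O zO] := tc_zero C.
have d1 := (dist_rot _ _ _).1 (dist_id W zO).
have d2 := (dist_rot _ _ _).1 d.
have [|c [_ e]] := dist_map (a := x) (b := (0 : phom O Z)) d1 d2.
  by rewrite comp0r gx0.
have [y [ey _]] := @shift_ff C _ _ c.
exists y; apply: shift_inj; move: e.
rewrite fmap_id compNr compNl mcomp_idr => /oppr_inj ->.
by rewrite fmap_comp ey.
Qed.

(** The five lemma, by a diagram chase with [dist_ker]: c has zero kernel and a right inverse c',
    and then c (c' c - 1) = 0 forces c' c = 1. *)
Lemma dist_iso3 (X Y Z X' Y' Z' : C)
    (f : hom X Y) (g : hom Y Z) (h : hom Z (shift X))
    (f' : hom X' Y') (g' : hom Y' Z') (h' : hom Z' (shift X'))
    (a : hom X X') (b : hom Y Y') (c : hom Z Z') :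
  dist f g h -> dist f' g' h' -> is_iso a -> is_iso b ->
  b \c f = f' \c a -> c \c g = g' \c b -> fmap shift a \c h = h' \c c -> is_iso c.
Proof.
move=> d d' ia ib e1 e2 e3.
have r := (dist_rot _ _ _).1 d; have r' := (dist_rot _ _ _).1 d'.
have rr := (dist_rot _ _ _).1 r.
have isa : is_iso (fmap shift a) by apply: fmap_iso.
have isb : is_iso (fmap shift b) by apply: fmap_iso.
have mono (W : C) (x : hom W Z) : c \c x = 0 :> phom W Z' -> x = (0 : phom W Z).
  move=> cx; have hx : h \c x = 0 :> phom W (shift X).
    by apply: (iso_mono isa); rewrite mcompA e3 -mcompA cx !comp0r.
  have [y ey] := dist_ker r hx.
  have : g' \c (b \c y) = 0 :> phom W Z' by rewrite mcompA -e2 -mcompA -ey.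
  move/(dist_ker d') => [w ew].
  have [a' [_ aa]] := ia.
  have yE : y = f \c (a' \c w).
    apply: (iso_mono ib); rewrite ew !mcompA e1; congr (_ \c _).
    by rewrite -mcompA aa mcomp_idr.
  by rewrite ey yE mcompA (dist_comp0 d) comp0l.
have [c' ec] : exists d : hom Z' Z, c \c d = idm Z'.
  have [sa [sa1 sa2]] := isa.
  pose v := sa \c h'.
  have : ((- (fmap shift f : phom (shift X) (shift Y)) : phom _ _) : @hom C _ _) \c v = 0 :> phom Z' (shift Y).
    rewrite compNl; apply/eqP; rewrite oppr_eq0; apply/eqP.
    apply: (iso_mono isb); rewrite comp0r /v !mcompA -fmap_comp e1 fmap_comp.
    rewrite -(mcompA _ _ sa) sa2 mcomp_idr.
    have := dist_comp0 ((dist_rot _ _ _).1 r').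
    by rewrite compNl => /eqP; rewrite oppr_eq0 => /eqP.
  move/(dist_ker rr) => [w ew].
  (* [c \c w] agrees with the identity only after composition with h'. The error z therefore factors
     as g' y', and adding g b^-1 y' to w repairs it. *)
  pose z : hom Z' Z' := (idm Z' : phom Z' Z') - (c \c w : phom Z' Z').
  have : h' \c z = 0 :> phom Z' (shift X').
    rewrite /z compDr compNr; apply/eqP; rewrite subr_eq0; apply/eqP.
    change (h' \c idm Z' = h' \c (c \c w)).
    by rewrite mcompA -e3 -mcompA -ew /v mcompA sa2 mcomp_idr mcomp_idl.
  move/(dist_ker r') => [y' ey'].
  have [b' [_ bb]] := ib.
  exists ((w : phom Z' Z) + (g \c (b' \c y') : phom Z' Z)).
  transitivity ((c \c w : phom Z' Z') + (c \c (g \c (b' \c y')) : phom Z' Z')).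
    exact: compDr.
  rewrite mcompA e2 -mcompA [b \c _]mcompA bb mcomp_idl -ey' /z.
  by rewrite addrC subrK.
exists c'; split => //.
have : (c' \c c : phom Z Z) - (idm Z : phom Z Z) = 0.
  apply: mono; rewrite compDr compNr.
  apply/eqP; rewrite subr_eq0; apply/eqP.
  change (c \c (c' \c c) = c \c idm Z).
  by rewrite mcompA ec mcomp_idl mcomp_idr.
by move/eqP; rewrite subr_eq0 => /eqP.
Qed.

Lemma iso_cone0 X Y Z (f : hom X Y) (g : hom Y Z) (h : hom Z (shift X)) :
  dist f g h -> is_iso f -> is_zero Z.
Proof.
move=> d i.
have g0 : g = (0 : phom Y Z).
  by apply: (iso_epi i); rewrite (dist_comp0 d) comp0l.
have d' := (dist_rot _ _ _).1 d; have d'' := (dist_rot _ _ _).1 d'.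
have h0 : h = (0 : phom Z (shift X)).
  have := dist_comp0 d''; rewrite compNl => /eqP; rewrite oppr_eq0 => /eqP e.
  by apply: (iso_mono (fmap_iso shift i)); rewrite e comp0r.
have [y ey] : exists y, idm Z = g \c y.
  by apply: (dist_ker d'); rewrite h0 comp0l.
by rewrite /is_zero ey g0 comp0l.
Qed.

Lemma cone0_iso X Y Z (f : hom X Y) (g : hom Y Z) (h : hom Z (shift X)) :
  dist f g h -> is_zero Z -> is_iso f.
Proof.
move=> d zZ.
have [y ey] : exists y, idm Y = f \c y by apply: (dist_ker d); apply: zero_cod.
exists y; split => //.
have mono (W : C) (x : hom W X) : f \c x = 0 :> phom W Y -> x = (0 : phom W X).
  move=> fx; have d'' := (dist_rot _ _ _).1 ((dist_rot _ _ _).1 d).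
  have [|w ew] := dist_ker d'' (x := (fmap shift x : phom _ _)).
    rewrite compNl -fmap_comp fx (fmap0 (@shift_additive C)).
    by rewrite oppr0.
  apply: shift_inj; rewrite ew (fmap0 (@shift_additive C)).
  by rewrite (zero_cod (A := C) w zZ) comp0r.
have : (y \c f : phom X X) - (idm X : phom X X) = 0.
  apply: mono; rewrite compDr compNr.
  apply/eqP; rewrite subr_eq0; apply/eqP.
  change (f \c (y \c f) = f \c idm X).
  by rewrite mcompA -ey mcomp_idl mcomp_idr.
by move/eqP; rewrite subr_eq0 => /eqP.
Qed.

End Triangles.

(** * Connection isomorphisms *)

Section Connection.
Variables (C : category) (fib : C -> category) (H : fibered fib).

(* The composite is passed as a separate arrow [k], so that both bracketings of a
   triple composite can share one pullback and [eq_hom] disappears.  The body is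
   locked because rewriting with [mcompA] sees through transparent definitions. *)
Definition cn (T S V : C) (f : hom T S) (g : hom S V) (k : hom T V) (e : k = g \c f)
    (A : fib V) : hom (pull H k A) (pull H f (pull H g A)) :=
  locked (conn H f g A \c eq_hom (f_equal (fun k => pull H k A : ob (fib T)) e)).

Definition cni (T S V : C) (f : hom T S) (g : hom S V) (k : hom T V) (e : k = g \c f)
    (A : fib V) : hom (pull H f (pull H g A)) (pull H k A) :=
  locked (eq_hom (f_equal (fun k => pull H k A : ob (fib T)) (esym e))
    \c ni_inv (conn H f g) A).

Lemma cn_erefl (T S V : C) (f : hom T S) (g : hom S V) A :
  cn (erefl (g \c f)) A = conn H f g A.
Proof. by rewrite /cn -lock; exact: mcomp_idr. Qed.

Section Basic.
Variables (T S V : C) (f : hom T S) (g : hom S V) (k : hom T V) (e : k = g \c f).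

Lemma cnK A : cni e A \c cn e A = idm (pull H k A).
Proof. by subst k; rewrite /cni /cn -!lock /= mcomp_idl mcomp_idr; exact: (ni_invl (conn H f g) A). Qed.

Lemma cniK A : cn e A \c cni e A = idm (pull H f (pull H g A)).
Proof. by subst k; rewrite /cni /cn -!lock /= mcomp_idl mcomp_idr; exact: (ni_invr (conn H f g) A). Qed.

Lemma cn_iso A : is_iso (cn e A).
Proof. by exists (cni e A); rewrite cnK cniK. Qed.

Lemma cni_iso A : is_iso (cni e A).
Proof. by exists (cn e A); rewrite cnK cniK. Qed.

Lemma cn_nat A B (x : hom A B) :
  fmap (pull H f) (fmap (pull H g) x) \c cn e A = cn e B \c fmap (pull H k) x.
Proof. by subst k; rewrite /cn -!lock /= !mcomp_idr; exact: (nt_nat (conn H f g) x). Qed.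

Lemma cni_nat A B (x : hom A B) :
  fmap (pull H k) x \c cni e A = cni e B \c fmap (pull H f) (fmap (pull H g) x).
Proof.
apply: (iso_mono (cn_iso B)); rewrite mcompA -cn_nat -mcompA cniK mcomp_idr.
by rewrite mcompA cniK mcomp_idl.
Qed.

End Basic.

Lemma cn_assoc (T S V W : C) (f : hom T S) (g : hom S V) (h : hom V W)
    (k1 : hom T V) (k2 : hom S W) (k : hom T W)
    (e1 : k1 = g \c f) (e2 : k2 = h \c g) (e3 : k = h \c k1) (e4 : k = k2 \c f) A :
  fmap (pull H f) (cn e2 A) \c cn e4 A = cn e1 (pull H h A) \c cn e3 A.
Proof.
subst k1 k2; move: e3; subst k => e3; rewrite /cn -!lock /= !mcomp_idr mcompA.
rewrite (proof_irrelevance _ e3 (esym (mcompA h g f))).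
exact: (conn_assoc H f g h A).
Qed.

Variable t : tensor H.

Definition tm (T S : C) (f : hom T S) (A B : fib S) :
  hom (tens t T (pull H f A, pull H f B)) (pull H f (tens t S (A, B))) := tens_m t f (A, B).
Definition tmi (T S : C) (f : hom T S) (A B : fib S) :
  hom (pull H f (tens t S (A, B))) (tens t T (pull H f A, pull H f B)) :=
  ni_inv (tens_m t f) (A, B).

Section BasicTensor.
Variables (T S : C) (f : hom T S).

Lemma tmK A B : tmi f A B \c tm f A B = idm _.
Proof. exact: (ni_invl (tens_m t f) (A, B)). Qed.

Lemma tmiK A B : tm f A B \c tmi f A B = idm _.
Proof. exact: (ni_invr (tens_m t f) (A, B)). Qed.

Lemma tm_iso A B : is_iso (tm f A B).
Proof. by exists (tmi f A B); rewrite tmK tmiK. Qed.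

Lemma tmi_iso A B : is_iso (tmi f A B).
Proof. by exists (tm f A B); rewrite tmK tmiK. Qed.

Lemma tm_nat A A' B B' (x : hom A A') (y : hom B B') :
  fmap (pull H f) (bmap (tens t S) x y) \c tm f A B =
  tm f A' B' \c bmap (tens t T) (fmap (pull H f) x) (fmap (pull H f) y).
Proof. exact: (@nt_nat _ _ _ _ (tens_m t f) (A, B) (A', B') (x, y)). Qed.

Lemma tmi_nat A A' B B' (x : hom A A') (y : hom B B') :
  bmap (tens t T) (fmap (pull H f) x) (fmap (pull H f) y) \c tmi f A B =
  tmi f A' B' \c fmap (pull H f) (bmap (tens t S) x y).
Proof.
apply: (iso_mono (tm_iso A' B')); rewrite mcompA -tm_nat -mcompA tmiK mcomp_idr.
by rewrite mcompA tmiK mcomp_idl.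
Qed.

End BasicTensor.

Lemma tm_comp (T S V : C) (f : hom T S) (g : hom S V) (k : hom T V) (e : k = g \c f)
    (A B : fib V) :
  cn e (tens t V (A, B)) \c tm k A B =
  fmap (pull H f) (tm g A B) \c tm f (pull H g A) (pull H g B)
    \c bmap (tens t T) (cn e A) (cn e B).
Proof. by subst k; rewrite /cn -!lock /= !mcomp_idr; apply: tens_m_comp. Qed.

Lemma tmi_comp (T S V : C) (f : hom T S) (g : hom S V) (k : hom T V) (e : k = g \c f)
    (A B : fib V) :
  tmi f (pull H g A) (pull H g B) \c fmap (pull H f) (tmi g A B)
    \c cn e (tens t V (A, B)) =
  bmap (tens t T) (cn e A) (cn e B) \c tmi k A B.
Proof.
apply: (iso_mono (tm_iso f _ _)); rewrite !mcompA tmiK mcomp_idl.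
apply: (iso_mono (fmap_iso (pull H f) (tm_iso g A B))).
rewrite !mcompA -fmap_comp tmiK fmap_id mcomp_idl.
by rewrite -tm_comp -mcompA tmiK mcomp_idr.
Qed.

End Connection.

Section ConnectionShift.
Variables (C : category) (H : tri_fibered C).

Lemma cn_shift (T S V : C) (f : hom T S) (g : hom S V) (k : hom T V) (e : k = g \c f)
    (A : tfib H V) :
  fmap shift (cn H e A) \c pull_shift H k A =
  pull_shift H f (pull H g A) \c fmap (pull H f) (pull_shift H g A) \c cn H e (shift A).
Proof. by subst k; rewrite !cn_erefl; apply: conn_tri. Qed.

End ConnectionShift.

(** * Extensions of the tensor structure at one object *)

Section Embeddings.
Variable S : base.

Lemma exists_embedding (X : S) :
  exists (V : Ucat S) (s : @hom S X (sval V)), closed_imm s.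
Proof.
have [P [t [p [ct sp ep]]]] := closed_smooth_fact (to_pt X).
have uP : in_U P by rewrite /in_U -(to_pt_uniq p).
by exists (exist _ P uP), t.
Qed.

(** Q is the product of Y and V. It lies in U because its projection to V is a base change of Y ->
    pt, and q = (s, g) is closed by cancellation, its first component s being closed. *)
Lemma exists_joint_embedding (X : S) (Y V : Ucat S)
    (s : @hom S X (sval Y)) (g : @hom S X (sval V)) : closed_imm s ->
  exists (Q : Ucat S) (q : @hom S X (sval Q))
    (p1 : @hom S (sval Q) (sval Y)) (p2 : @hom S (sval Q) (sval V)),
    [/\ closed_imm q, s = p1 \c q, g = p2 \c q,
        forall W (a : @hom S W (sval Y)) (b : @hom S W (sval V)),
          exists c, a = p1 \c c /\ b = p2 \c c
      & forall W (c c' : @hom S W (sval Q)),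
          p1 \c c = p1 \c c' -> p2 \c c = p2 \c c' -> c = c'].
Proof.
move=> cs; have [Q [q1 [q2 univ]]] := base_prod (sval Y) (sval V).
have cart : cartesian q1 q2 (to_pt (sval Y)) (to_pt (sval V)).
  split; first by rewrite (to_pt_uniq (_ \c q2)) (to_pt_uniq (_ \c q1)).
  by move=> W a b _; apply: univ.
have uQ : in_U Q.
  rewrite /in_U -(to_pt_uniq (to_pt (sval V) \c q2)).
  by apply: smooth_comp (svalP V) _; apply: smooth_pb cart (svalP Y).
have [q [[e1 e2] _]] := univ _ s g.
exists (exist _ Q uQ), q, q1, q2; split => //.
- by apply: (closed_cancel (g := q1)); rewrite e1.
- by move=> W a b; have [c [[c1 c2] _]] := univ _ a b; exists c.
- move=> W c c' h1 h2; have [d [_ u]] := univ _ (q1 \c c) (q2 \c c).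
  by rewrite -(u c) // -(u c').
Qed.

End Embeddings.

Section Localic.
Variables (S : base) (H : tri_fibered S) (hH : localic H).

Definition star (Z B : S) (z : hom Z B) (hz : closed_imm z) :
    functor (tfib H Z) (tfib H B) :=
  proj1_sig (constructive_indefinite_description _ (loc_star hH hz)).

Definition star_adj (Z B : S) (z : hom Z B) (hz : closed_imm z) :
    adjunction (pull H z) (star hz) :=
  epsilon (proj2_sig (constructive_indefinite_description _ (loc_star hH hz)))
          (fun _ => True).

Section Star.
Variables (Z B : S) (z : hom Z B) (hz : closed_imm z).

Definition eps (A : tfib H Z) : hom (pull H z (star hz A)) A :=
  adj_counit (star_adj hz) A.

Lemma eps_iso A : is_iso (eps A).
Proof. by apply: ff_counit_iso; apply: loc_star_ff (star_adj hz). Qed.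

Lemma eps_nat A A' (x : hom A A') :
  x \c eps A = eps A' \c fmap (pull H z) (fmap (star hz) x).
Proof. exact: counit_nat. Qed.

Definition epsi (A : tfib H Z) : hom A (pull H z (star hz A)) := iso_inv (eps_iso A).

Lemma epsi_iso A : is_iso (epsi A). Proof. exact: iso_inv_iso. Qed.
Lemma epsiK A : eps A \c epsi A = idm _. Proof. exact: iso_invr. Qed.

Lemma epsi_nat A A' (x : hom A A') :
  epsi A' \c x = fmap (pull H z) (fmap (star hz) x) \c epsi A.
Proof.
apply: (iso_mono (eps_iso _)); rewrite !mcompA epsiK mcomp_idl -eps_nat.
by rewrite -mcompA epsiK mcomp_idr.
Qed.

Definition eta (A : tfib H B) : hom A (star hz (pull H z A)) := adj_unit (star_adj hz) A.

Lemma eta_iso A : is_iso (fmap (pull H z) (eta A)).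
Proof. by apply: ff_unit_iso; apply: loc_star_ff (star_adj hz). Qed.

Lemma eps_eta A : eps (pull H z A) \c fmap (pull H z) (eta A) = idm _.
Proof. exact: adj_tri1. Qed.

Lemma epsi_eta A : epsi (pull H z A) = fmap (pull H z) (eta A).
Proof. by apply: (iso_mono (eps_iso _)); rewrite eps_eta epsiK. Qed.

Definition hat A X (x : hom (pull H z A) X) : hom A (star hz X) :=
  locked (transpose (star_adj hz) x).

Lemma eps_hat A X (x : hom (pull H z A) X) :
  eps X \c fmap (pull H z) (hat x) = x.
Proof. rewrite /hat -lock; exact: counit_transpose. Qed.

(** This lifts isomorphisms over the closed subobject to morphisms over the ambient object that z^*
    inverts, the input of [pull_tensor_iso]. *)
Lemma hat_iso A X (x : hom (pull H z A) X) :
  is_iso x -> is_iso (fmap (pull H z) (hat x)).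
Proof. by move=> ix; apply: (is_iso_cancel_l (eps_iso X)); rewrite eps_hat. Qed.

Lemma hat_compl A X X' (a : hom X X') (x : hom (pull H z A) X) :
  hat (a \c x) = fmap (star hz) a \c hat x.
Proof. rewrite /hat -!lock; exact: transpose_compl. Qed.

Lemma hat_compr A A' X (x : hom (pull H z A) X) (c : hom A' A) :
  hat (x \c fmap (pull H z) c) = hat x \c c.
Proof. rewrite /hat -!lock; exact: transpose_compr. Qed.

End Star.

Variable t : tri_tensor (restrictU H).

(** The fibres are written as those of [H]; those of [restrictU H] agree with them only up to
    conversion, which rewriting does not see through. *)
Definition tU (V : Ucat S) :
    functor (prod_cat (tfib H (sval V)) (tfib H (sval V))) (tfib H (sval V)) :=
  tens t V.

Definition mU (V W : Ucat S) (h : @hom S (sval V) (sval W)) (A B : tfib H (sval W)) :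
    hom (tU V (pull H h A, pull H h B)) (pull H h (tU W (A, B))) :=
  @tm _ _ _ t V W h A B.
Definition mUi (V W : Ucat S) (h : @hom S (sval V) (sval W)) (A B : tfib H (sval W)) :
    hom (pull H h (tU W (A, B))) (tU V (pull H h A, pull H h B)) :=
  @tmi _ _ _ t V W h A B.

Section TensorU.
Variables (V W : Ucat S) (h : @hom S (sval V) (sval W)).
Implicit Types A B : tfib H (sval W).

Lemma mUK A B : mUi h A B \c mU h A B = idm _.
Proof. exact: (@tmK _ _ _ t V W h). Qed.
Lemma mU_iso A B : is_iso (mU h A B).
Proof. exact: (@tm_iso _ _ _ t V W h). Qed.
Lemma mUi_iso A B : is_iso (mUi h A B).
Proof. exact: (@tmi_iso _ _ _ t V W h). Qed.
Lemma mU_nat A A' B B' (x : hom A A') (y : hom B B') :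
  fmap (pull H h) (bmap (tU W) x y) \c mU h A B =
  mU h A' B' \c bmap (tU V) (fmap (pull H h) x) (fmap (pull H h) y).
Proof. exact: (@tm_nat _ _ _ t V W h). Qed.
Lemma mUi_nat A A' B B' (x : hom A A') (y : hom B B') :
  bmap (tU V) (fmap (pull H h) x) (fmap (pull H h) y) \c mUi h A B =
  mUi h A' B' \c fmap (pull H h) (bmap (tU W) x y).
Proof. exact: (@tmi_nat _ _ _ t V W h). Qed.
End TensorU.

Lemma mU_comp (T V W : Ucat S) (f : @hom S (sval T) (sval V))
    (g : @hom S (sval V) (sval W)) (k : @hom S (sval T) (sval W)) (e : k = g \c f) A B :
  cn H e (tU W (A, B)) \c mU k A B =
  fmap (pull H f) (mU g A B) \c mU f (pull H g A) (pull H g B)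
    \c bmap (tU T) (cn H e A) (cn H e B).
Proof. exact: (@tm_comp _ _ _ t T V W f g k e). Qed.

Lemma mUi_comp (T V W : Ucat S) (f : @hom S (sval T) (sval V))
    (g : @hom S (sval V) (sval W)) (k : @hom S (sval T) (sval W)) (e : k = g \c f) A B :
  mUi f (pull H g A) (pull H g B) \c fmap (pull H f) (mUi g A B) \c cn H e (tU W (A, B)) =
  bmap (tU T) (cn H e A) (cn H e B) \c mUi k A B.
Proof. exact: (@tmi_comp _ _ _ t T V W f g k e). Qed.

(* What an extension of [t] from U to the base consists of at the single object X:
   the bifunctor on H(X) and the isomorphisms m_g for all g from X to objects of U. *)
Record extension (X : S) := Extension {
  xF : functor (prod_cat (tfib H X) (tfib H X)) (tfib H X);
  xM : forall (V : Ucat S) (g : @hom S X (sval V)) (A B : tfib H (sval V)),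
    hom (xF (pull H g A, pull H g B)) (pull H g (tU V (A, B)));
  xM_nat : forall (V : Ucat S) (g : @hom S X (sval V)) A A' B B' (x : hom A A') (y : hom B B'),
    fmap (pull H g) (bmap (tU V) x y) \c xM g A B =
    xM g A' B' \c bmap xF (fmap (pull H g) x) (fmap (pull H g) y);
  xM_iso : forall (V : Ucat S) (g : @hom S X (sval V)) A B, is_iso (xM g A B);
  xM_comp : forall (V W : Ucat S) (g : @hom S X (sval V)) (h : @hom S (sval V) (sval W))
      (k : @hom S X (sval W)) (e : k = h \c g) A B,
    cn H e (tU W (A, B)) \c xM k A B =
    fmap (pull H g) (mU h A B) \c xM g (pull H h A) (pull H h B)
      \c bmap xF (cn H e A) (cn H e B)
}.

(* For a closed immersion s into an object of U, every object of H(X) is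
   isomorphic to a pullback s^* s_* A. *)
Lemma descent_uniq (X : S) (K : category) (G R : tfib H X -> tfib H X -> K)
    (Gm : forall A A' B B', hom A A' -> hom B B' -> hom (G A B) (G A' B'))
    (Rm : forall A A' B B', hom A A' -> hom B B' -> hom (R A B) (R A' B'))
    (nu nu' : forall A B, hom (G A B) (R A B)) :
  (forall A A' B B' (x : hom A A') (y : hom B B'),
     is_iso x -> is_iso y -> is_iso (Gm _ _ _ _ x y)) ->
  (forall A A' B B' (x : hom A A') (y : hom B B'),
     Rm _ _ _ _ x y \c nu A B = nu A' B' \c Gm _ _ _ _ x y) ->
  (forall A A' B B' (x : hom A A') (y : hom B B'),
     Rm _ _ _ _ x y \c nu' A B = nu' A' B' \c Gm _ _ _ _ x y) ->
  (forall (V : Ucat S) (g : @hom S X (sval V)) A B,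
     nu (pull H g A) (pull H g B) = nu' (pull H g A) (pull H g B)) ->
  forall A B, nu A B = nu' A B.
Proof.
move=> iG n n' e A B; have [V [s hs]] := exists_embedding X.
by apply: (iso_epi (iG _ _ _ _ _ _ (eps_iso hs A) (eps_iso hs B))); rewrite -n -n' e.
Qed.

Section Universal.
Variables (X : S) (E : extension X) (K : category).
Variables (Phi : functor (tfib H X) K) (G : functor (prod_cat (tfib H X) (tfib H X)) K).
Variable N : forall (V : Ucat S) (g : @hom S X (sval V)) (A B : tfib H (sval V)),
  hom (G (pull H g A, pull H g B)) (Phi (pull H g (tU V (A, B)))).

(* Universal property of an extension F: a family N_g : G(g^*A, g^*B) -> Phi(g^*(A (x) B))
   compatible with the m_h of [t] is Phi(m_g) composed with a unique G -> Phi F. *)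
Definition coherent : Prop :=
  (forall (V : Ucat S) (g : @hom S X (sval V)) A A' B B' (x : hom A A') (y : hom B B'),
    fmap Phi (fmap (pull H g) (bmap (tU V) x y)) \c N g A B =
    N g A' B' \c bmap G (fmap (pull H g) x) (fmap (pull H g) y)) /\
  (forall (V W : Ucat S) (g : @hom S X (sval V)) (h : @hom S (sval V) (sval W))
      (k : @hom S X (sval W)) (e : k = h \c g) A B,
    fmap Phi (cn H e (tU W (A, B))) \c N k A B =
    fmap Phi (fmap (pull H g) (mU h A B)) \c N g (pull H h A) (pull H h B)
      \c bmap G (cn H e A) (cn H e B)).

(** The value that the wanted transformation must take at a pair pulled back along g. It depends a
    priori on g and is natural only for morphisms pulled back from V. *)
Definition tau (V : Ucat S) (g : @hom S X (sval V)) A B :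
    hom (G (pull H g A, pull H g B)) (Phi (xF E (pull H g A, pull H g B))) :=
  locked (fmap Phi (iso_inv (xM_iso E g A B)) \c N g A B).

Let FM (V : Ucat S) (g : @hom S X (sval V)) A B := fmap_iso Phi (@xM_iso X E V g A B).

Let tauE (V : Ucat S) (g : @hom S X (sval V)) A B :
  fmap Phi (xM E g A B) \c tau g A B = N g A B.
Proof. by rewrite /tau -lock mcompA -fmap_comp iso_invr fmap_id mcomp_idl. Qed.

Hypothesis cohN : coherent.

Let tau_nat (V : Ucat S) (g : @hom S X (sval V)) A A' B B' (x : hom A A') (y : hom B B') :
  fmap Phi (bmap (xF E) (fmap (pull H g) x) (fmap (pull H g) y)) \c tau g A B =
  tau g A' B' \c bmap G (fmap (pull H g) x) (fmap (pull H g) y).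
Proof.
apply: (iso_mono (FM g A' B')); rewrite !mcompA tauE -cohN.1 -fmap_comp -xM_nat.
by rewrite fmap_comp -mcompA tauE.
Qed.

Let tau_comp (V W : Ucat S) (g : @hom S X (sval V)) (h : @hom S (sval V) (sval W))
    (k : @hom S X (sval W)) (e : k = h \c g) A B :
  fmap Phi (bmap (xF E) (cn H e A) (cn H e B)) \c tau k A B =
  tau g (pull H h A) (pull H h B) \c bmap G (cn H e A) (cn H e B).
Proof.
apply: (iso_mono (FM g _ _)).
apply: (iso_mono (fmap_iso Phi (fmap_iso (pull H g) (mU_iso h A B)))).
rewrite (reassoc1 (tauE _ _ _)) !mcompA -cohN.2 -!fmap_comp -xM_comp.
by rewrite fmap_comp -mcompA tauE.
Qed.

Let Ys := constructive_indefinite_description _ (exists_embedding X).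
Let Y := proj1_sig Ys.
Let ss := constructive_indefinite_description _ (proj2_sig Ys).
Let s := proj1_sig ss.
Let hs := proj2_sig ss.

(** Only the chosen embedding s enters. Naturality in all morphisms of H(X) holds because s_* turns
    each of them into one pulled back from Y. *)
Definition nu (A B : tfib H X) : hom (G (A, B)) (Phi (xF E (A, B))) :=
  locked (fmap Phi (bmap (xF E) (eps hs A) (eps hs B)) \c tau s (star hs A) (star hs B)
    \c bmap G (epsi hs A) (epsi hs B)).

Lemma nu_nat A A' B B' (x : hom A A') (y : hom B B') :
  fmap Phi (bmap (xF E) x y) \c nu A B = nu A' B' \c bmap G x y.
Proof.
rewrite /nu -!lock !mcompA -fmap_comp bmap_comp !eps_nat -bmap_comp fmap_comp -!mcompA.
by rewrite (reassoc (tau_nat _ _ _)) !bmap_comp !epsi_nat.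
Qed.

(** Moves an equality with [nu] along isomorphisms in either direction, as needed for a zigzag whose
    arrows point opposite ways. *)
Let transport (A A' B B' : tfib H X) (x : hom A A') (y : hom B B') ta ta' :
  is_iso x -> is_iso y ->
  fmap Phi (bmap (xF E) x y) \c ta = ta' \c bmap G x y ->
  ta = nu A B <-> ta' = nu A' B'.
Proof.
move=> ix iy e; split => e'.
  apply: (iso_epi (bmap_iso G ix iy)).
  by rewrite -e e' nu_nat.
apply: (iso_mono (fmap_iso Phi (bmap_iso (xF E) ix iy))).
by rewrite e e' nu_nat.
Qed.

(** At a pullback the inverse counit is s^* of the unit, hence a morphism for which [tau] is
    natural. *)
Let tau_nu_s A B : tau s A B = nu (pull H s A) (pull H s B).
Proof.
rewrite /nu -!lock !epsi_eta -mcompA -tau_nat mcompA -fmap_comp bmap_comp !eps_eta.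
by rewrite bmap_id fmap_id mcomp_idl.
Qed.

(** Independence of g: the claim passes from g to q along p2, then inside H(Q) to objects pulled
    back along p1, and from q to s along p1. Since q^* inverts the morphisms used in H(Q),
    naturality of [tau] along q suffices there. *)
Let tau_nu (V : Ucat S) (g : @hom S X (sval V)) A B : tau g A B = nu (pull H g A) (pull H g B).
Proof.
have [Q [q [p1 [p2 [cq e1 e2 _ _]]]]] := exists_joint_embedding g hs.
apply/(transport (cn_iso H e2 A) (cn_iso H e2 B) (tau_comp e2 A B)).
move: (pull H p2 A) (pull H p2 B) => {}A {}B.
(* A -> q_* q^* A <- p1^* s_* q^* A is a zigzag of morphisms inverted by q^*. *)
apply/(transport (eta_iso cq A) (eta_iso cq B) (tau_nat _ _ _)).
set A' := pull H q A; set B' := pull H q B.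
have zig C : exists c : hom (pull H p1 (star hs C)) (star cq C), is_iso (fmap (pull H q) c).
  exists (hat cq (eps hs C \c cni H e1 _)); apply: hat_iso.
  by apply: is_iso_comp; [apply: eps_iso | apply: cni_iso].
have [a ia] := zig A'; have [b ib] := zig B'.
apply/(transport ia ib (tau_nat _ _ _)).
apply/(transport (cn_iso H e1 _) (cn_iso H e1 _) (tau_comp e1 _ _)).
exact: tau_nu_s.
Qed.

Lemma nuE (V : Ucat S) (g : @hom S X (sval V)) A B :
  fmap Phi (xM E g A B) \c nu (pull H g A) (pull H g B) = N g A B.
Proof. by rewrite -tau_nu tauE. Qed.

Lemma nu_uniq (nu' : forall A B, hom (G (A, B)) (Phi (xF E (A, B)))) :
  (forall A A' B B' (x : hom A A') (y : hom B B'),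
     fmap Phi (bmap (xF E) x y) \c nu' A B = nu' A' B' \c bmap G x y) ->
  (forall (V : Ucat S) (g : @hom S X (sval V)) A B,
     fmap Phi (xM E g A B) \c nu' (pull H g A) (pull H g B) = N g A B) ->
  forall A B, nu' A B = nu A B.
Proof.
move=> n e; apply: (descent_uniq (Gm := fun A A' B B' x y => bmap G x y)
  (Rm := fun A A' B B' x y => fmap Phi (bmap (xF E) x y))) => // [*|*|].
- exact: bmap_iso.
- exact: nu_nat.
- by move=> V g A B; apply: (iso_mono (FM g A B)); rewrite nuE e.
Qed.

Lemma nu_iso : (forall (V : Ucat S) (g : @hom S X (sval V)) A B, is_iso (N g A B)) ->
  forall A B, is_iso (nu A B).
Proof.
move=> iN A B; rewrite /nu -!lock; apply: is_iso_comp.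
  apply: is_iso_comp; first by apply: fmap_iso; apply: bmap_iso; apply: eps_iso.
  by rewrite /tau -lock; apply: is_iso_comp => //; apply: fmap_iso; apply: iso_inv_iso.
by apply: bmap_iso; apply: epsi_iso.
Qed.

End Universal.
End Localic.

(** * The kernel of the restriction to a closed subobject is a tensor ideal *)

Lemma left_adjoint_zero (A B : preadditive) (L : functor A B) (R : functor B A)
    (adj : adjunction L R) X : is_zero X -> is_zero (L X).
Proof.
move=> zX; apply: (transpose_inj (adj := adj)).
by rewrite (zero_dom (A := A) (transpose adj (idm (L X))) zX); symmetry; apply: zero_dom.
Qed.

Lemma eq_hom_iso (C : category) (X Y : C) (e : X = Y) : is_iso (eq_hom e).
Proof. by case: Y / e; apply: is_iso_id. Qed.

Section OpenClosed.
Variables (S : base) (H : tri_fibered S) (hH : localic H).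

Lemma square_swap_iso (P' P T B : S)
    (f' : hom P' P) (p' : hom P' T) (p : hom P B) (f : hom T B)
    (e : p \c f' = f \c p') (A : tfib H B) : is_iso (square_swap e A).
Proof.
apply: is_iso_comp; first apply: is_iso_comp.
- exact: (natiso_iso (conn H p' f) A).
- exact: eq_hom_iso.
- exists (conn H f' p A); split; [exact: (ni_invr (conn H f' p)) | exact: (ni_invl (conn H f' p))].
Qed.

Variables (Z B : S) (z : hom Z B) (hz : closed_imm z).
Let u := compl_imm hz.
Variables (L : functor (tfib H (compl hz)) (tfib H B)) (adj : adjunction L (pull H u)).

(** The fibre product of z and u is empty: u factors through itself, so the universal property of
    the complement applies to it. Base change then computes z^* u_# D through H(empty) = 0. *)
Lemma pull_sharp_zero D : is_zero (pull H z (L D)).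
Proof.
have [cart _] := compl_image hz u.
have {}cart := cart (ex_intro _ (idm _) (mcomp_idr u)).
have su := compl_smooth hz.
have [L' [adj']] := loc_sharp hH (smooth_pb cart su).
apply: (is_zero_iso (loc_base_change hH cart su adj adj' D)).
by apply: (left_adjoint_zero adj'); apply: loc_empty hH _.
Qed.

Lemma pull_id_ff (Y : S) : fully_faithful (pull H (idm Y)).
Proof. by rewrite pull_id => X X' g; exists g; split. Qed.

(* Base change for the square of u against itself, both of whose projections are
   the identity since u is a monomorphism. *)
Lemma open_unit_iso D : is_iso (adj_unit adj D).
Proof.
have cart : cartesian (idm _) (idm _) u u.
  split=> // X a b e; have {}e := compl_inj e; subst b.
  by exists a; split; [rewrite mcomp_idl | move=> c [<- _]; rewrite mcomp_idl].
have su := compl_smooth hz.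
have [L' [adj']] := loc_sharp hH (smooth_iso (is_iso_id (compl hz))).
have ff := @pull_id_ff (compl hz).
have := loc_base_change hH cart su adj adj' D.
rewrite /base_change -mcompA => /(is_iso_cancel_l (ff_counit_iso adj' ff _)).
move/(is_iso_cancel_l (fmap_iso L' (square_swap_iso _ _))) => i.
(* By [i], the functor L' id^* sends the unit to an isomorphism. The counit L' id^* -> id is
   invertible and natural, so the unit itself is an isomorphism. *)
apply: (is_iso_cancel_r (ff_counit_iso adj' ff _)).
rewrite (counit_nat adj'); apply: is_iso_comp => //.
exact: ff_counit_iso.
Qed.

(** By conservativity: after z^* both sides vanish, and after u^* the counit is inverse to the unit
    by a triangle identity. *)
Lemma sharp_counit_iso C : is_zero (pull H z C) -> is_iso (adj_counit adj C).
Proof.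
move=> zC; apply: (loc_conservative hH (hz := hz)).
  by apply: zero_iso => //; apply: pull_sharp_zero.
exact: (is_iso_inv (adj_tri2 adj C) (open_unit_iso _)).
Qed.

End OpenClosed.

Section KeyLemma.
Variables (S : base) (H : tri_fibered S) (hH : localic H).
Variables (t : tri_tensor (restrictU H)) (ht : localic_tensor (@Usmooth S) t).
Variables (Z : S) (V : Ucat S) (z : @hom S Z (sval V)) (hz : closed_imm z).

Let Uc : Ucat S.
Proof.
exists (compl hz); rewrite /in_U -(to_pt_uniq (to_pt (sval V) \c compl_imm hz)).
by apply: smooth_comp (svalP V) _; apply: compl_smooth.
Defined.

(* A = u_# u^* A, so A (x) B = u_#(u^* A (x) u^* B) by the projection formula,
   and z^* u_# = 0. *)
Lemma tensor_zerol A B : is_zero (pull H z A) -> is_zero (pull H z (tU t V (A, B))).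
Proof.
move=> zA; have [L [adj]] := loc_sharp hH (compl_smooth hz).
have i := (ht (p := compl_imm hz : @hom (Ucat S) Uc V) (compl_smooth hz) adj).1.
have ie := sharp_counit_iso hH adj zA.
apply: (is_zero_iso (fmap_iso (pull H z) (bmap_iso (tU t V) ie (is_iso_id B)))).
apply: (is_zero_iso (fmap_iso (pull H z) (i _ B))).
exact: (pull_sharp_zero hH (hz := hz) adj).
Qed.

Lemma tensor_zeror A B : is_zero (pull H z B) -> is_zero (pull H z (tU t V (A, B))).
Proof.
move=> zB; have [L [adj]] := loc_sharp hH (compl_smooth hz).
have i := (ht (p := compl_imm hz : @hom (Ucat S) Uc V) (compl_smooth hz) adj).2.
have ie := sharp_counit_iso hH adj zB.
apply: (is_zero_iso (fmap_iso (pull H z) (bmap_iso (tU t V) (is_iso_id A) ie))).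
apply: (is_zero_iso (fmap_iso (pull H z) (i A _))).
exact: (pull_sharp_zero hH (hz := hz) adj).
Qed.

(** Factor x (x) y as (x (x) 1)(1 (x) y). By exactness the cone of each factor is the tensor product
    with the cone of x or y, which z^* kills; the ideal property kills the product. *)
Lemma pull_tensor_iso A A' B B' (x : hom A A') (y : hom B B') :
  is_iso (fmap (pull H z) x) -> is_iso (fmap (pull H z) y) ->
  is_iso (fmap (pull H z) (bmap (tU t V) x y)).
Proof.
have pd := tri_dist (pull_tri H z).
move=> ix iy; rewrite -(mcomp_idl x) -(mcomp_idr y) -bmap_comp fmap_comp.
apply: is_iso_comp.
  have [C [g [h d]]] := dist_cone y.
  apply: (cone0_iso (pd _ _ _ _ _ _ (bitri_distr (tt_bitri t V) A' d))).
  by apply: tensor_zeror; apply: (iso_cone0 (pd _ _ _ _ _ _ d)).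
have [C [g [h d]]] := dist_cone x.
apply: (cone0_iso (pd _ _ _ _ _ _ (bitri_distl (tt_bitri t V) B d))).
by apply: tensor_zerol; apply: (iso_cone0 (pd _ _ _ _ _ _ d)).
Qed.

End KeyLemma.

(** * Existence of extensions *)

Section Existence.
Variables (S : base) (H : tri_fibered S) (hH : localic H).
Variables (t : tri_tensor (restrictU H)) (ht : localic_tensor (@Usmooth S) t).
Variable X : S.

Section Roof.
Variables (Q : Ucat S) (q : @hom S X (sval Q)) (hq : closed_imm q).

(* g^*(A' (x) B') = q^*(p^* A' (x) p^* B') -> q^*(q_* A (x) q_* B), induced by the
   adjuncts p^* A' -> q_* A and p^* B' -> q_* B of a and b. *)
Definition roof (V : Ucat S) (p : @hom S (sval Q) (sval V)) (g : @hom S X (sval V))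
    (e : g = p \c q) (A' B' : tfib H (sval V)) (A B : tfib H X)
    (a : hom (pull H g A') A) (b : hom (pull H g B') B) :
    hom (pull H g (tU t V (A', B')))
        (pull H q (tU t Q (star hH hq A, star hH hq B))) :=
  locked (fmap (pull H q)
            (bmap (tU t Q) (hat hH hq (a \c cni H e A')) (hat hH hq (b \c cni H e B'))
               \c mUi t p A' B')
            \c cn H e (tU t V (A', B'))).

Lemma roof_iso V p g e A' B' A B a b :
  is_iso a -> is_iso b -> is_iso (@roof V p g e A' B' A B a b).
Proof.
move=> ia ib; rewrite /roof -lock fmap_comp.
apply: is_iso_comp; last exact: cn_iso.
apply: is_iso_comp; last by apply: fmap_iso; apply: mUi_iso.
by apply: pull_tensor_iso => //; apply: hat_iso; apply: is_iso_comp => //; apply: cni_iso.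
Qed.

Lemma roof_natl V p g e A' B' A B a b A2 B2 (x : hom A A2) (y : hom B B2) :
  fmap (pull H q) (bmap (tU t Q) (fmap (star hH hq) x) (fmap (star hH hq) y))
    \c @roof V p g e A' B' A B a b = roof e (x \c a) (y \c b).
Proof.
rewrite /roof -!lock mcompA -fmap_comp mcompA bmap_comp.
by rewrite -!hat_compl !mcompA.
Qed.

(** It serves twice: with identities for [x] and [y] it gives compatibility of m_g with h, and with
    a closed immersion in the role of [g] it compares roofs over two joint embeddings. *)
Lemma roof_comp (V W : Ucat S) (p : @hom S (sval Q) (sval V)) (g : @hom S X (sval V))
    (h : @hom S (sval V) (sval W)) (k : @hom S X (sval W)) (ph : @hom S (sval Q) (sval W))
    (e : g = p \c q) (ek : k = h \c g) (ep : ph = h \c p) (ekq : k = ph \c q)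
    A' B' A B (a : hom (pull H g A') A) (b : hom (pull H g B') B)
    A2 B2 (x : hom (pull H h A2) A') (y : hom (pull H h B2) B') :
  roof ekq (a \c fmap (pull H g) x \c cn H ek A2) (b \c fmap (pull H g) y \c cn H ek B2) =
  roof e a b \c fmap (pull H g) (bmap (tU t V) x y \c mUi t h A2 B2)
    \c cn H ek (tU t W (A2, B2)).
Proof.
(* On adjuncts the claim is the cocycle identity of the connection isomorphisms for q, p and h. *)
have E C C2 (c : hom (pull H g C) C2) D (w : hom (pull H h D) C) :
    hat hH hq (c \c fmap (pull H g) w \c cn H ek D \c cni H ekq D) =
    hat hH hq (c \c cni H e C) \c fmap (pull H p) w \c cn H ep D.
  rewrite -!hat_compr; congr hat; rewrite -!mcompA; congr (_ \c _).
  rewrite (reassoc (esym (cni_nat H e w))); congr (_ \c _).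
  apply: (iso_mono (cn_iso H e _)); rewrite (reassoc1 (cniK _ _ _)) mcomp_idl mcompA.
  by rewrite -(cn_assoc H e ep ek ekq) -mcompA cniK mcomp_idr.
rewrite /roof -!lock !E -!mcompA -(reassoc (cn_nat H e _)).
rewrite -(cn_assoc H e ep ek ekq) !(mcompA (fmap (pull H q) _)) -!fmap_comp.
rewrite [RHS]mcompA -fmap_comp; congr (fmap _ _ \c _).
rewrite -!bmap_comp -!mcompA; congr (_ \c _).
by rewrite -mUi_comp fmap_comp -!mcompA (reassoc (mUi_nat t p x y)).
Qed.

Lemma roof_natr V p g e A' B' A B a b A2 B2 (x : hom A2 A') (y : hom B2 B') :
  @roof V p g e A' B' A B a b \c fmap (pull H g) (bmap (tU t V) x y) =
  roof e (a \c fmap (pull H g) x) (b \c fmap (pull H g) y).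
Proof.
rewrite /roof -!lock -!mcompA !(cni_nat H e) -(cn_nat H e) !(mcompA _ (cni H e _)).
rewrite !(hat_compr hH hq) mcompA -fmap_comp -mcompA -mUi_nat.
by rewrite mcompA bmap_comp.
Qed.

End Roof.

Variables (Y : Ucat S) (s : @hom S X (sval Y)) (hs : closed_imm s).

Definition embF : functor (prod_cat (tfib H X) (tfib H X)) (tfib H X) :=
  fcomp (pull H s) (fcomp (tU t Y) (Defs.fprod (star hH hs) (star hH hs))).

(* Quantifying over all q dominating s and g makes m_g independent of the choice of
   a joint embedding. *)
Definition is_embM (V : Ucat S) (g : @hom S X (sval V)) A B
    (M : hom (embF (pull H g A, pull H g B)) (pull H g (tU t V (A, B)))) : Prop :=
  forall (Q : Ucat S) (q : @hom S X (sval Q)) (hq : closed_imm q)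
    (p1 : @hom S (sval Q) (sval Y)) (p2 : @hom S (sval Q) (sval V))
    (e1 : s = p1 \c q) (e2 : g = p2 \c q),
  roof hq e2 (idm (pull H g A)) (idm (pull H g B)) \c M =
  roof hq e1 (eps hH hs (pull H g A)) (eps hH hs (pull H g B)).

(** The product embedding q dictates M. Any other q' maps to it by some r, and the same M works
    there. *)
Lemma embM_ex (V : Ucat S) (g : @hom S X (sval V)) A B : exists M, @is_embM V g A B M.
Proof.
have [Q [q [p1 [p2 [cq e1 e2 univ uniq]]]]] := exists_joint_embedding g hs.
pose i := roof_iso cq e2 (is_iso_id (pull H g A)) (is_iso_id (pull H g B)).
exists (iso_inv i \c roof cq e1 (eps hH hs (pull H g A)) (eps hH hs (pull H g B))).
move=> Q' q' cq' p1' p2' e1' e2'.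
have [r [r1 r2]] := univ _ p1' p2'.
have er : q = r \c q' by apply: uniq; rewrite mcompA -?r1 -?r2 -?e1' -?e2'.
(* The roof over q' is the roof over q followed by a morphism that depends only on the targets, so
   the equation for q implies the one for q'. *)
have E (W : Ucat S) (g' : @hom S X (sval W)) p p' (e : g' = p \c q) (e' : g' = p' \c q')
    (ep : p' = p \c r) A' B' C D (a : hom (pull H g' A') C) (b : hom (pull H g' B') D) :
    roof cq' e' a b = roof cq' er (eps hH cq C) (eps hH cq D) \c roof cq e a b.
  have hatE C' C2 (c : hom (pull H g' C') C2) :
      c = eps hH cq C2 \c fmap (pull H q) (hat hH cq (c \c cni H e C')) \c cn H e C'.
    by rewrite eps_hat -mcompA cnK mcomp_idr.
  rewrite [in LHS](hatE _ _ a) [in LHS](hatE _ _ b).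
  by rewrite (roof_comp cq' er e ep e') -mcompA {3}/roof -lock.
rewrite (E _ _ _ _ e2 e2' r2) (E _ _ _ _ e1 e1' r1) -!mcompA; congr (_ \c _).
by rewrite mcompA iso_invr mcomp_idl.
Qed.

Definition embM (V : Ucat S) (g : @hom S X (sval V)) A B :
    hom (embF (pull H g A, pull H g B)) (pull H g (tU t V (A, B))) :=
  proj1_sig (constructive_indefinite_description _ (embM_ex g A B)).

Lemma embMP (V : Ucat S) (g : @hom S X (sval V)) A B : is_embM (embM g A B).
Proof. exact: proj2_sig (constructive_indefinite_description _ (embM_ex g A B)). Qed.

Let joint (V : Ucat S) (g : @hom S X (sval V)) : exists (Q : Ucat S)
    (q : @hom S X (sval Q)) (p1 : @hom S (sval Q) (sval Y)) (p2 : @hom S (sval Q) (sval V)),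
  [/\ closed_imm q, s = p1 \c q & g = p2 \c q].
Proof.
by have [Q [q [p1 [p2 [? ? ? _ _]]]]] := exists_joint_embedding g hs; exists Q, q, p1, p2.
Qed.

Lemma embM_iso (V : Ucat S) (g : @hom S X (sval V)) A B : is_iso (embM g A B).
Proof.
have [Q [q [p1 [p2 [cq e1 e2]]]]] := joint g.
have i := roof_iso cq e2 (is_iso_id (pull H g A)) (is_iso_id (pull H g B)).
apply: (is_iso_cancel_l i); rewrite (embMP _ _ cq e1 e2).
by apply: roof_iso; apply: eps_iso.
Qed.

Lemma embM_nat (V : Ucat S) (g : @hom S X (sval V)) A A' B B' (x : hom A A') (y : hom B B') :
  fmap (pull H g) (bmap (tU t V) x y) \c embM g A B =
  embM g A' B' \c bmap embF (fmap (pull H g) x) (fmap (pull H g) y).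
Proof.
have [Q [q [p1 [p2 [cq e1 e2]]]]] := joint g.
have i := roof_iso cq e2 (is_iso_id (pull H g A')) (is_iso_id (pull H g B')).
apply: (iso_mono i); rewrite !mcompA (embMP _ _ cq e1 e2) roof_natr !mcomp_idl.
have -> : bmap embF (fmap (pull H g) x) (fmap (pull H g) y) =
  fmap (pull H s) (bmap (tU t Y) (fmap (star hH hs) (fmap (pull H g) x))
                                 (fmap (star hH hs) (fmap (pull H g) y))) by [].
rewrite roof_natr -!eps_nat -!roof_natl -(embMP _ _ cq e1 e2) mcompA.
by rewrite roof_natl !mcomp_idr.
Qed.

Lemma embM_comp (V W : Ucat S) (g : @hom S X (sval V)) (h : @hom S (sval V) (sval W))
    (k : @hom S X (sval W)) (e : k = h \c g) A B :
  cn H e (tU t W (A, B)) \c embM k A B =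
  fmap (pull H g) (mU t h A B) \c embM g (pull H h A) (pull H h B)
    \c bmap embF (cn H e A) (cn H e B).
Proof.
have [Q [q [p1 [p2 [cq e1 e2]]]]] := joint g.
(* The same q dominates k, through h p2, so both sides can be tested by roofs over one embedding. *)
have e3 : k = h \c p2 \c q by rewrite e e2 mcompA.
have i := roof_iso cq e2 (is_iso_id (pull H g (pull H h A))) (is_iso_id (pull H g (pull H h B))).
have im := fmap_iso (pull H g) (mUi_iso t h A B).
apply: (iso_mono im); rewrite -!mcompA (reassoc1 (_ : _ = idm _)); last first.
  by rewrite -fmap_comp mUK fmap_id.
rewrite mcomp_idl; apply: (iso_mono i).
rewrite [in RHS]mcompA (embMP _ _ cq e1 e2).
have -> : bmap embF (cn H e A) (cn H e B) =
  fmap (pull H s) (bmap (tU t Y) (fmap (star hH hs) (cn H e A))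
                                 (fmap (star hH hs) (cn H e B))) by [].
rewrite roof_natr -!eps_nat -roof_natl -(embMP _ _ cq e1 e3) [RHS]mcompA roof_natl.
have := roof_comp cq e2 e erefl e3 (idm (pull H g (pull H h A)))
  (idm (pull H g (pull H h B))) (idm (pull H h A)) (idm (pull H h B)).
rewrite !fmap_id !mcomp_idl !mcomp_idr bmap_id mcomp_idl => ->.
by rewrite -!mcompA.
Qed.

Definition embedding_extension : extension t X :=
  @Extension S H t X embF embM embM_nat embM_iso embM_comp.

End Existence.

(** * The extended structure *)

Section PullEndo.
Variables (S : base) (H : tri_fibered S).

(* Abstracts over the pairs (shift, id) and (id, shift), which treats both shift
   isomorphisms of the tensor product at once. *)
Record pull_endofunctor := PullEndofunctor {
  pe_fun :> forall X : S, functor (tfib H X) (tfib H X);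
  pe_pull : forall (T X : S) (f : hom T X) (A : tfib H X),
    hom (pull H f (pe_fun X A)) (pe_fun T (pull H f A));
  pe_nat : forall (T X : S) (f : hom T X) (A B : tfib H X) (x : hom A B),
    fmap (pe_fun T) (fmap (pull H f) x) \c pe_pull f A =
    pe_pull f B \c fmap (pull H f) (fmap (pe_fun X) x);
  pe_iso : forall (T X : S) (f : hom T X) (A : tfib H X), is_iso (pe_pull f A);
  pe_cn : forall (T X V : S) (f : hom T X) (g : hom X V) (k : hom T V)
      (e : k = g \c f) (A : tfib H V),
    fmap (pe_fun T) (cn H e A) \c pe_pull k A =
    pe_pull f (pull H g A) \c fmap (pull H f) (pe_pull g A) \c cn H e (pe_fun V A)
}.

Definition shift_endo : pull_endofunctor :=
  @PullEndofunctor (fun X => shift) (fun T X f A => pull_shift H f A)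
    (fun T X f A B x => tri_nat (pull_tri H f) x)
    (fun T X f A => tri_iso (pull_tri H f) A)
    (fun T X V f g k e A => cn_shift e A).

Lemma id_endo_cn (T X V : S) (f : hom T X) (g : hom X V) (k : hom T V)
    (e : k = g \c f) (A : tfib H V) :
  cn H e A \c idm (pull H k A) =
  idm (pull H f (pull H g A)) \c fmap (pull H f) (idm (pull H g A)) \c cn H e A.
Proof. by rewrite fmap_id !mcomp_idl mcomp_idr. Qed.

Definition id_endo : pull_endofunctor :=
  @PullEndofunctor (fun X => fid _) (fun T X f A => idm (pull H f A))
    (fun T X f A B x => id_nat (pull H f) x)
    (fun T X f A => is_iso_id (pull H f A))
    id_endo_cn.

End PullEndo.

(** * The isomorphisms m_f and the shift isomorphisms, from the universal property *)

Section Build.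
Variables (S : base) (H : tri_fibered S) (hH : localic H) (t : tri_tensor (restrictU H)).
Variable E : forall X : S, extension t X.

Section Pull.
Variables (T X : S) (f : hom T X).

(** The value that the composition law forces on f^*(m_g) m_f: the arrow g f ends in U, so its m is
    part of the extension at T. *)
Definition ext_mN (V : Ucat S) (g : @hom S X (sval V)) A B :
    hom (fcomp (xF (E T)) (Defs.fprod (pull H f) (pull H f)) (pull H g A, pull H g B))
        (pull H f (pull H g (tU t V (A, B)))) :=
  locked (cn H (erefl (g \c f)) (tU t V (A, B)) \c xM (E T) (g \c f) A B
    \c bmap (xF (E T)) (cni H (erefl (g \c f)) A) (cni H (erefl (g \c f)) B)).

Lemma ext_mNE (V : Ucat S) (g : @hom S X (sval V)) (k : @hom S T (sval V)) (e : k = g \c f) A B :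
  ext_mN g A B \c bmap (xF (E T)) (cn H e A) (cn H e B) =
  cn H e (tU t V (A, B)) \c xM (E T) k A B.
Proof. by subst k; rewrite /ext_mN -lock -!mcompA bmap_comp !cnK bmap_id mcomp_idr. Qed.

Lemma ext_mN_coherent : coherent (Phi := pull H f) ext_mN.
Proof.
split=> [V g A A' B B' x y | V W g h k e A B].
  have i := bmap_iso (xF (E T)) (cn_iso H (erefl (g \c f)) A) (cn_iso H (erefl (g \c f)) B).
  apply: (iso_epi i); rewrite -!mcompA ext_mNE.
  rewrite bmap_prel.
  rewrite bmap_comp !cn_nat -bmap_comp mcompA (reassoc (ext_mNE erefl _ _)) cn_nat.
  by rewrite -!mcompA xM_nat.
have [l [e1 e2]] : exists l, l = k \c f /\ l = h \c (g \c f).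
  by exists (k \c f); rewrite e mcompA.
have i := bmap_iso (xF (E T)) (cn_iso H e1 A) (cn_iso H e1 B).
have ea := cn_assoc H (erefl (g \c f)) e e2 e1.
apply: (iso_epi i); rewrite -!mcompA ext_mNE.
rewrite bmap_prel.
rewrite bmap_comp !ea -bmap_comp (reassoc (ext_mNE erefl _ _)).
rewrite (reassoc (ea _)) (reassoc (cn_nat H (erefl _) (mU t h A B))).
by rewrite (xM_comp (E T) e2) -!mcompA.
Qed.

Definition ext_m (A B : tfib H X) :
    hom (xF (E T) (pull H f A, pull H f B)) (pull H f (xF (E X) (A, B))) :=
  nu hH (E X) ext_mN A B.

Lemma ext_m_nat A A' B B' (x : hom A A') (y : hom B B') :
  fmap (pull H f) (bmap (xF (E X)) x y) \c ext_m A B =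
  ext_m A' B' \c bmap (xF (E T)) (fmap (pull H f) x) (fmap (pull H f) y).
Proof. exact: (nu_nat hH (E X) ext_mN_coherent x y). Qed.

Lemma ext_mE (V : Ucat S) (g : @hom S X (sval V)) (k : @hom S T (sval V)) (e : k = g \c f) A B :
  fmap (pull H f) (xM (E X) g A B) \c (ext_m (pull H g A) (pull H g B)
    \c bmap (xF (E T)) (cn H e A) (cn H e B)) =
  cn H e (tU t V (A, B)) \c xM (E T) k A B.
Proof. by rewrite -ext_mNE -(nuE hH (E X) ext_mN_coherent) mcompA. Qed.

Lemma ext_m_iso A B : is_iso (ext_m A B).
Proof.
move: A B; apply: (nu_iso hH (E X) (N := ext_mN)) => V g A B.
apply: (is_iso_cancel_r (bmap_iso (xF (E T)) (cn_iso H erefl A) (cn_iso H erefl B))).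
by rewrite ext_mNE; apply: is_iso_comp; [apply: cn_iso | apply: xM_iso].
Qed.

End Pull.

(** Both sides are natural, so descent reduces to objects pulled back along some h to U. There
    [ext_mE] expresses each m through extension data, and the cocycle identity remains. *)
Lemma ext_m_comp (T X V : S) (f : hom T X) (g : hom X V) (k : hom T V) (e : k = g \c f) A B :
  cn H e (xF (E V) (A, B)) \c ext_m k A B =
  fmap (pull H f) (ext_m g A B) \c ext_m f (pull H g A) (pull H g B)
    \c bmap (xF (E T)) (cn H e A) (cn H e B).
Proof.
move: A B; apply: (descent_uniq hH
  (Gm := fun A A' B B' x y => bmap (xF (E T)) (fmap (pull H k) x) (fmap (pull H k) y))
  (Rm := fun A A' B B' x y => fmap (pull H f) (fmap (pull H g) (bmap (xF (E V)) x y)))).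
- by move=> *; apply: bmap_iso; apply: fmap_iso.
- move=> A A' B B' x y; lazy beta.
  by rewrite mcompA cn_nat -!mcompA ext_m_nat.
- move=> A A' B B' x y; lazy beta.
  rewrite !mcompA -fmap_comp ext_m_nat fmap_comp -!mcompA (reassoc (ext_m_nat _ _ _)).
  by rewrite !bmap_comp !cn_nat.
move=> W h A B.
(* One name for the triple composite, with both bracketings as equations, is the form [cn_assoc]
   expects. *)
have [l [e1 e2]] : exists l, l = h \c k /\ l = (h \c g) \c f.
  by exists (h \c k); rewrite e mcompA.
have [l' e3] : exists l', l' = h \c g by exists (h \c g).
rewrite -e3 in e2; have ea := cn_assoc H e e3 e1 e2.
have i := bmap_iso (xF (E T)) (cn_iso H e1 A) (cn_iso H e1 B).
have j := fmap_iso (pull H f) (fmap_iso (pull H g) (xM_iso (E V) h A B)).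
apply: (iso_epi i); apply: (iso_mono j).
rewrite !mcompA cn_nat -!mcompA bmap_comp -!ea -bmap_comp.
rewrite ext_mE -(reassoc (ea _)).
rewrite -(reassoc (ext_m_nat _ _ _)) (reassoc1 (esym (fmap_comp _ _ _))).
rewrite (reassoc1 (esym (fmap_comp _ _ _))) -mcompA.
by rewrite ext_mE fmap_comp -mcompA ext_mE.
Qed.

Section Shift.
Variables s1 s2 s3 : pull_endofunctor H.
Variable b : forall (V : Ucat S) (A B : tfib H (sval V)),
  hom (tU t V (s1 _ A, s2 _ B)) (s3 _ (tU t V (A, B))).
Hypothesis b_nat : forall (V : Ucat S) (A A' B B' : tfib H (sval V)) (x : hom A A') (y : hom B B'),
  fmap (s3 _) (bmap (tU t V) x y) \c b A B =
  b A' B' \c bmap (tU t V) (fmap (s1 _) x) (fmap (s2 _) y).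
Hypothesis b_pull : forall (V W : Ucat S) (h : @hom S (sval V) (sval W)) (A B : tfib H (sval W)),
  fmap (s3 _) (mU t h A B) \c b (pull H h A) (pull H h B)
    \c bmap (tU t V) (pe_pull s1 h A) (pe_pull s2 h B) =
  pe_pull s3 h (tU t W (A, B)) \c fmap (pull H h) (b A B) \c mU t h (s1 _ A) (s2 _ B).

Section Fiber.
Variable X : S.

(** The value forced by compatibility with pullback: [b] over V, pulled back along g and conjugated
    by the exchange of g^* with the three endofunctors. *)
Definition ext_shN (V : Ucat S) (g : @hom S X (sval V)) A B :
    hom (fcomp (xF (E X)) (Defs.fprod (s1 X) (s2 X)) (pull H g A, pull H g B))
        (s3 X (pull H g (tU t V (A, B)))) :=
  locked (pe_pull s3 g (tU t V (A, B)) \c fmap (pull H g) (b A B)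
    \c xM (E X) g (s1 _ A) (s2 _ B)
    \c bmap (xF (E X)) (iso_inv (pe_iso s1 g A)) (iso_inv (pe_iso s2 g B))).

Lemma ext_shNE (V : Ucat S) (g : @hom S X (sval V)) A B :
  ext_shN g A B \c bmap (xF (E X)) (pe_pull s1 g A) (pe_pull s2 g B) =
  pe_pull s3 g (tU t V (A, B)) \c fmap (pull H g) (b A B)
    \c xM (E X) g (s1 _ A) (s2 _ B).
Proof. by rewrite /ext_shN -lock -!mcompA bmap_comp !iso_invl bmap_id mcomp_idr. Qed.

Lemma ext_shN_coherent : coherent (Phi := s3 X) ext_shN.
Proof.
split=> [V g A A' B B' x y | V W g h k e A B].
  have i := bmap_iso (xF (E X)) (pe_iso s1 g A) (pe_iso s2 g B).
  apply: (iso_epi i); rewrite -!mcompA ext_shNE.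
  rewrite bmap_prel.
  rewrite bmap_comp !pe_nat -bmap_comp (reassoc (ext_shNE _ _ _)) -!mcompA.
  rewrite (reassoc (pe_nat _ _ _)) -xM_nat !(reassoc1 (esym (fmap_comp _ _ _))).
  by rewrite b_nat.
have i := bmap_iso (xF (E X)) (pe_iso s1 k A) (pe_iso s2 k B).
apply: (iso_epi i); rewrite -!mcompA ext_shNE.
rewrite bmap_prel.
rewrite bmap_comp !pe_cn -!bmap_comp -!mcompA (reassoc (ext_shNE _ _ _)).
rewrite (reassoc (pe_cn _ _ _)) -!mcompA (reassoc (pe_nat _ _ _)).
rewrite -(reassoc (cn_nat _ _ _)) xM_comp -(reassoc (xM_nat _ _ _ _)).
rewrite !(reassoc1 (esym (fmap_comp _ _ _))) -!mcompA.
rewrite !(reassoc1 (esym (fmap_comp _ _ _))) -!mcompA.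
by have := b_pull h A B; rewrite -!mcompA => ->.
Qed.

Definition ext_sh (A B : tfib H X) :
    hom (xF (E X) (s1 X A, s2 X B)) (s3 X (xF (E X) (A, B))) :=
  nu hH (E X) ext_shN A B.

Lemma ext_sh_nat A A' B B' (x : hom A A') (y : hom B B') :
  fmap (s3 X) (bmap (xF (E X)) x y) \c ext_sh A B =
  ext_sh A' B' \c bmap (xF (E X)) (fmap (s1 X) x) (fmap (s2 X) y).
Proof. exact: (nu_nat hH (E X) ext_shN_coherent x y). Qed.

Lemma ext_shE (V : Ucat S) (g : @hom S X (sval V)) A B :
  fmap (s3 X) (xM (E X) g A B) \c (ext_sh (pull H g A) (pull H g B)
    \c bmap (xF (E X)) (pe_pull s1 g A) (pe_pull s2 g B)) =
  pe_pull s3 g (tU t V (A, B)) \c fmap (pull H g) (b A B)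
    \c xM (E X) g (s1 _ A) (s2 _ B).
Proof. by rewrite -ext_shNE -(nuE hH (E X) ext_shN_coherent) mcompA. Qed.

Lemma ext_sh_iso : (forall (V : Ucat S) (A B : tfib H (sval V)), is_iso (b A B)) ->
  forall A B, is_iso (ext_sh A B).
Proof.
move=> ib; apply: (nu_iso hH (E X) (N := @ext_shN)) => V g A B.
apply: (is_iso_cancel_r (bmap_iso (xF (E X)) (pe_iso s1 g A) (pe_iso s2 g B))).
rewrite ext_shNE; apply: is_iso_comp; last exact: xM_iso.
by apply: is_iso_comp; [apply: pe_iso | apply: fmap_iso].
Qed.

End Fiber.

(** This becomes the compatibility of m_f with the shifts. Descent reduces it to pullbacks along g,
    where [ext_mE] and [ext_shE] for g and g f leave only [pe_cn]. *)
Lemma ext_sh_pull (T X : S) (f : hom T X) (A B : tfib H X) :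
  fmap (s3 T) (ext_m f A B) \c ext_sh (pull H f A) (pull H f B)
    \c bmap (xF (E T)) (pe_pull s1 f A) (pe_pull s2 f B) =
  pe_pull s3 f (xF (E X) (A, B)) \c fmap (pull H f) (ext_sh A B) \c ext_m f (s1 X A) (s2 X B).
Proof.
move: A B; apply: (descent_uniq hH
  (Gm := fun A A' B B' x y =>
     bmap (xF (E T)) (fmap (pull H f) (fmap (s1 X) x)) (fmap (pull H f) (fmap (s2 X) y)))
  (Rm := fun A A' B B' x y => fmap (s3 T) (fmap (pull H f) (bmap (xF (E X)) x y)))).
- by move=> *; apply: bmap_iso; do 2 apply: fmap_iso.
- move=> A A' B B' x y; lazy beta.
  rewrite !mcompA -fmap_comp ext_m_nat fmap_comp -!mcompA (reassoc (ext_sh_nat _ _)).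
  by rewrite !bmap_comp !pe_nat.
- move=> A A' B B' x y; lazy beta.
  rewrite !mcompA pe_nat -!mcompA.
  by rewrite (reassoc1 (esym (fmap_comp _ _ _))) ext_sh_nat fmap_comp -!mcompA ext_m_nat.
move=> V g A B; set k := g \c f; have e : k = g \c f by [].
(* Precomposition with [i] makes the source a pair of pullbacks along k, where the defining
   equations for k apply. *)
have i := bmap_iso (xF (E T))
  (is_iso_comp (fmap_iso (pull H f) (pe_iso s1 g A)) (cn_iso H e (s1 _ A)))
  (is_iso_comp (fmap_iso (pull H f) (pe_iso s2 g B)) (cn_iso H e (s2 _ B))).
have j := fmap_iso (s3 T) (fmap_iso (pull H f) (xM_iso (E X) g A B)).
apply: (iso_epi i); apply: (iso_mono j).
have q1 : pe_pull s1 f (pull H g A) \c (fmap (pull H f) (pe_pull s1 g A) \c cn H e (s1 _ A)) =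
  fmap (s1 T) (cn H e A) \c pe_pull s1 k A by rewrite mcompA -pe_cn.
have q2 : pe_pull s2 f (pull H g B) \c (fmap (pull H f) (pe_pull s2 g B) \c cn H e (s2 _ B)) =
  fmap (s2 T) (cn H e B) \c pe_pull s2 k B by rewrite mcompA -pe_cn.
rewrite -!mcompA [in LHS]bmap_comp q1 q2 -[in LHS]bmap_comp -(reassoc (ext_sh_nat _ _)).
rewrite !(reassoc1 (esym (fmap_comp (s3 T) _ _))) -!mcompA ext_mE fmap_comp -!mcompA ext_shE.
rewrite (reassoc (pe_nat _ _ _)) -bmap_comp -(reassoc (ext_m_nat _ _ _)).
rewrite !(reassoc1 (esym (fmap_comp (pull H f) _ _))) -!mcompA ext_shE !fmap_comp -!mcompA ext_mE.
by rewrite (reassoc (cn_nat _ _ _)) (reassoc (pe_cn _ _ _)) -!mcompA.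
Qed.

End Shift.
End Build.

(** * Additivity, exactness and the sign rule for the extended tensor product *)

Section Bitriangulated.
Variables (S : base) (H : tri_fibered S) (hH : localic H) (t : tri_tensor (restrictU H)).
Variable E : forall X : S, extension t X.
Let sh := shift_endo H.
Let ie := id_endo H.

Definition bslU (V : Ucat S) (A B : tfib H (sval V)) :
  hom (tU t V (sh _ A, ie _ B)) (sh _ (tU t V (A, B))) := bsl (tt_shift t V) A B.
Definition bsrU (V : Ucat S) (A B : tfib H (sval V)) :
  hom (tU t V (ie _ A, sh _ B)) (sh _ (tU t V (A, B))) := bsr (tt_shift t V) A B.

Lemma bslU_nat (V : Ucat S) (A A' B B' : tfib H (sval V)) (x : hom A A') (y : hom B B') :
  fmap (sh _) (bmap (tU t V) x y) \c bslU A B =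
  bslU A' B' \c bmap (tU t V) (fmap (sh _) x) (fmap (ie _) y).
Proof. exact: (bitri_natl (tt_bitri t V) x y). Qed.

Lemma bsrU_nat (V : Ucat S) (A A' B B' : tfib H (sval V)) (x : hom A A') (y : hom B B') :
  fmap (sh _) (bmap (tU t V) x y) \c bsrU A B =
  bsrU A' B' \c bmap (tU t V) (fmap (ie _) x) (fmap (sh _) y).
Proof. exact: (bitri_natr (tt_bitri t V) x y). Qed.

Lemma bslU_pull (V W : Ucat S) (h : @hom S (sval V) (sval W)) (A B : tfib H (sval W)) :
  fmap (sh _) (mU t h A B) \c bslU (pull H h A) (pull H h B)
    \c bmap (tU t V) (pe_pull sh h A) (pe_pull ie h B) =
  pe_pull sh h (tU t W (A, B)) \c fmap (pull H h) (bslU A B) \c mU t h (sh _ A) (ie _ B).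
Proof. by rewrite -mcompA; exact: (@tt_m_bitri _ _ t V W h A B).1. Qed.

Lemma bsrU_pull (V W : Ucat S) (h : @hom S (sval V) (sval W)) (A B : tfib H (sval W)) :
  fmap (sh _) (mU t h A B) \c bsrU (pull H h A) (pull H h B)
    \c bmap (tU t V) (pe_pull ie h A) (pe_pull sh h B) =
  pe_pull sh h (tU t W (A, B)) \c fmap (pull H h) (bsrU A B) \c mU t h (ie _ A) (sh _ B).
Proof. by rewrite -mcompA; exact: (@tt_m_bitri _ _ t V W h A B).2. Qed.

Section Fiber.
Variable X : S.
Let F := xF (E X).

Definition ext_bsl (A B : tfib H X) : hom (F (shift A, B)) (shift (F (A, B))) :=
  ext_sh hH E bslU A B.
Definition ext_bsr (A B : tfib H X) : hom (F (A, shift B)) (shift (F (A, B))) :=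
  ext_sh hH E bsrU A B.

Lemma ext_bsl_nat (A A' B B' : tfib H X) (x : hom A A') (y : hom B B') :
  fmap shift (bmap F x y) \c ext_bsl A B = ext_bsl A' B' \c bmap F (fmap shift x) y.
Proof. exact: (ext_sh_nat hH E bslU_nat bslU_pull x y). Qed.

Lemma ext_bsr_nat (A A' B B' : tfib H X) (x : hom A A') (y : hom B B') :
  fmap shift (bmap F x y) \c ext_bsr A B = ext_bsr A' B' \c bmap F x (fmap shift y).
Proof. exact: (ext_sh_nat hH E bsrU_nat bsrU_pull x y). Qed.

Lemma ext_bslE (V : Ucat S) (g : @hom S X (sval V)) A B :
  fmap shift (xM (E X) g A B) \c (ext_bsl (pull H g A) (pull H g B)
    \c bmap F (pull_shift H g A) (idm (pull H g B))) =
  pull_shift H g (tU t V (A, B)) \c fmap (pull H g) (bsl (tt_shift t V) A B)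
    \c xM (E X) g (shift A) B.
Proof. exact: (ext_shE hH E bslU_nat bslU_pull g A B). Qed.

Lemma ext_bsrE (V : Ucat S) (g : @hom S X (sval V)) A B :
  fmap shift (xM (E X) g A B) \c (ext_bsr (pull H g A) (pull H g B)
    \c bmap F (idm (pull H g A)) (pull_shift H g B)) =
  pull_shift H g (tU t V (A, B)) \c fmap (pull H g) (bsr (tt_shift t V) A B)
    \c xM (E X) g A (shift B).
Proof. exact: (ext_shE hH E bsrU_nat bsrU_pull g A B). Qed.

Lemma ext_bsl_iso A B : is_iso (ext_bsl A B).
Proof.
by apply: (ext_sh_iso hH E (b := bslU)) => V A1 B1; exact: (bitri_isol (tt_bitri t V)).
Qed.

Lemma ext_bsr_iso A B : is_iso (ext_bsr A B).
Proof.
by apply: (ext_sh_iso hH E (b := bsrU)) => V A1 B1; exact: (bitri_isor (tt_bitri t V)).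
Qed.

Section Lift.
Variables (V : Ucat S) (s : @hom S X (sval V)) (hs : closed_imm s).

Definition xMi (A B : tfib H (sval V)) :
    hom (pull H s (tU t V (A, B))) (F (pull H s A, pull H s B)) :=
  iso_inv (xM_iso (E X) s A B).

Lemma xMi_nat A A' B B' (x : hom A A') (y : hom B B') :
  bmap F (fmap (pull H s) x) (fmap (pull H s) y) \c xMi A B =
  xMi A' B' \c fmap (pull H s) (bmap (tU t V) x y).
Proof.
apply: (iso_mono (xM_iso (E X) s A' B')).
rewrite !mcompA -xM_nat iso_invr mcomp_idl -mcompA iso_invr.
exact: mcomp_idr.
Qed.

Lemma bmap_pull A A' B B' (x : hom A A') (y : hom B B') :
  bmap F (fmap (pull H s) x) (fmap (pull H s) y) =
  xMi A' B' \c (fmap (pull H s) (bmap (tU t V) x y) \c xM (E X) s A B).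
Proof. by rewrite mcompA -xMi_nat -mcompA iso_invl mcomp_idr. Qed.

Lemma ext_bsl_xMi A B :
  ext_bsl (pull H s A) (pull H s B) \c (bmap F (pull_shift H s A) (idm (pull H s B))
    \c xMi (shift A) B) =
  fmap shift (xMi A B) \c (pull_shift H s (tU t V (A, B))
    \c fmap (pull H s) (bsl (tt_shift t V) A B)).
Proof.
apply: (iso_mono (fmap_iso shift (xM_iso (E X) s A B))).
have e := ext_bslE s A B; rewrite !mcompA -mcompA in e *.
rewrite e -(mcompA _ (xM _ _ _ _)) iso_invr mcomp_idr.
by rewrite -fmap_comp iso_invr fmap_id mcomp_idl.
Qed.

Lemma ext_bsr_xMi A B :
  ext_bsr (pull H s A) (pull H s B) \c (bmap F (idm (pull H s A)) (pull_shift H s B)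
    \c xMi A (shift B)) =
  fmap shift (xMi A B) \c (pull_shift H s (tU t V (A, B))
    \c fmap (pull H s) (bsr (tt_shift t V) A B)).
Proof.
apply: (iso_mono (fmap_iso shift (xM_iso (E X) s A B))).
have e := ext_bsrE s A B; rewrite !mcompA -mcompA in e *.
rewrite e -(mcompA _ (xM _ _ _ _)) iso_invr mcomp_idr.
by rewrite -fmap_comp iso_invr fmap_id mcomp_idl.
Qed.

(** This bypasses additivity of s_*: the sum of s_* f and s_* f' also lifts f + f', because s^* is
    additive. *)
Lemma eps_add (A A' : tfib H X) (f f' : phom A A') :
  ((f + f' : phom A A') : hom A A') \c eps hH hs A =
  eps hH hs A' \c fmap (pull H s) ((fmap (star hH hs) f : phom _ _) + fmap (star hH hs) f' : phom _ _).
Proof.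
rewrite compDl !eps_nat (tri_additive (pull_tri H s)) compDr.
by [].
Qed.

Lemma xF_addl (A A' B : tfib H X) (f f' : phom A A') :
  bmap F (f + f' : phom A A') (idm B) =
  (bmap F f (idm B) : phom (F (A, B)) (F (A', B))) + bmap F f' (idm B).
Proof.
have i := bmap_iso F (eps_iso hH hs A) (eps_iso hH hs B).
(* The formula holds for every lift [y] of [x], not only for s_* x, so it applies to the sum of two
   lifts. *)
have key (x : hom A A') (y : hom (star hH hs A) (star hH hs A')) :
    x \c eps hH hs A = eps hH hs A' \c fmap (pull H s) y ->
    bmap F x (idm B) \c bmap F (eps hH hs A) (eps hH hs B) =
    bmap F (eps hH hs A') (eps hH hs B) \c (xMi _ _
      \c (fmap (pull H s) (bmap (tU t V) y (idm (star hH hs B))) \c xM (E X) s _ _)).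
  by move=> e; rewrite -bmap_pull fmap_id !bmap_comp e mcomp_idl mcomp_idr.
apply: (iso_epi i); rewrite compDl (key _ _ (eps_add f f')).
rewrite (key f _ (eps_nat _ _ f)) (key f' _ (eps_nat _ _ f')).
by rewrite (bitri_addl (tt_bitri t V)) (tri_additive (pull_tri H s)) compDl !compDr.
Qed.

Lemma xF_addr (A B B' : tfib H X) (g g' : phom B B') :
  bmap F (idm A) (g + g' : phom B B') =
  (bmap F (idm A) g : phom (F (A, B)) (F (A, B'))) + bmap F (idm A) g'.
Proof.
have i := bmap_iso F (eps_iso hH hs A) (eps_iso hH hs B).
have key (x : hom B B') (y : hom (star hH hs B) (star hH hs B')) :
    x \c eps hH hs B = eps hH hs B' \c fmap (pull H s) y ->
    bmap F (idm A) x \c bmap F (eps hH hs A) (eps hH hs B) =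
    bmap F (eps hH hs A) (eps hH hs B') \c (xMi _ _
      \c (fmap (pull H s) (bmap (tU t V) (idm (star hH hs A)) y) \c xM (E X) s _ _)).
  by move=> e; rewrite -bmap_pull fmap_id !bmap_comp e mcomp_idl mcomp_idr.
apply: (iso_epi i); rewrite compDl (key _ _ (eps_add g g')).
rewrite (key g _ (eps_nat _ _ g)) (key g' _ (eps_nat _ _ g')).
by rewrite (bitri_addr (tt_bitri t V)) (tri_additive (pull_tri H s)) compDl !compDr.
Qed.

(* Every distinguished triangle of H(X) is isomorphic to the pullback of a
   distinguished triangle of H(V). *)
Lemma dist_lift (A B C : tfib H X) (f : hom A B) (g : hom B C) (h : hom C (shift A)) :
  dist f g h ->
  exists (C' : tfib H (sval V)) (g' : hom (star hH hs B) C') (h' : hom C' (shift (star hH hs A)))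
    (c : hom (pull H s C') C),
    [/\ dist (fmap (star hH hs) f) g' h', is_iso c,
        c \c fmap (pull H s) g' = g \c eps hH hs B
      & h \c c = fmap shift (eps hH hs A) \c pull_shift H s _ \c fmap (pull H s) h'].
Proof.
move=> d; have [C' [g' [h' d']]] := dist_cone (fmap (star hH hs) f).
have d2 := tri_dist (pull_tri H s) d'.
have [c [c1 c2]] := dist_map d2 d (esym (eps_nat hH hs f)).
exists C', g', h', c; split => //; last by rewrite -c2 mcompA.
exact: (dist_iso3 d2 d (eps_iso hH hs A) (eps_iso hH hs B) (esym (eps_nat hH hs f)) c1 c2).
Qed.

(** Lift the triangle to H(V), tensor it there with s_* B and pull back; counits and m_s^-1 identify
    the result with the required triangle. The square involving the shift is [ext_bsl_xMi]. *)
Lemma xF_distl (A1 A2 A3 B : tfib H X) (f : hom A1 A2) (g : hom A2 A3)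
    (h : hom A3 (shift A1)) : dist f g h ->
  dist (bmap F f (idm B)) (bmap F g (idm B)) (ext_bsl A1 B \c bmap F h (idm B)).
Proof.
move=> /dist_lift [C [g' [h' [c [d ic c1 c2]]]]].
have {}d := tri_dist (pull_tri H s) (bitri_distl (tt_bitri t V) (star hH hs B) d).
have im A' B' : is_iso (xMi A' B') by apply: iso_inv_iso.
have ie' A' := eps_iso hH hs A'.
apply: (dist_iso (a := bmap F (eps hH hs A1) (eps hH hs B) \c xMi _ _)
  (b := bmap F (eps hH hs A2) (eps hH hs B) \c xMi _ _)
  (c := bmap F c (eps hH hs B) \c xMi _ _)) d;
  try by apply: is_iso_comp => //; apply: bmap_iso.
- by rewrite -mcompA -xMi_nat fmap_id !mcompA !bmap_comp -eps_nat mcomp_idl mcomp_idr.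
- by rewrite -mcompA -xMi_nat fmap_id !mcompA !bmap_comp c1 mcomp_idl mcomp_idr.
rewrite [in RHS]mcompA -(mcompA (ext_bsl _ _)) bmap_comp c2 mcomp_idl.
have -> : bmap F (fmap shift (eps hH hs A1) \c pull_shift H s _ \c fmap (pull H s) h')
    (eps hH hs B) = bmap F (fmap shift (eps hH hs A1)) (eps hH hs B)
      \c (bmap F (pull_shift H s _) (idm _) \c bmap F (fmap (pull H s) h') (fmap (pull H s) (idm _))).
  by rewrite !bmap_comp fmap_id !mcomp_idl mcomp_idr mcompA.
rewrite -!mcompA xMi_nat -(reassoc (ext_bsl_nat _ _)) (mcompA _ (xMi _ _)).
by rewrite (reassoc (ext_bsl_xMi _ _)) !fmap_comp -!mcompA.
Qed.

Lemma xF_distr (A B1 B2 B3 : tfib H X) (f : hom B1 B2) (g : hom B2 B3)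
    (h : hom B3 (shift B1)) : dist f g h ->
  dist (bmap F (idm A) f) (bmap F (idm A) g) (ext_bsr A B1 \c bmap F (idm A) h).
Proof.
move=> /dist_lift [C [g' [h' [c [d ic c1 c2]]]]].
have {}d := tri_dist (pull_tri H s) (bitri_distr (tt_bitri t V) (star hH hs A) d).
have im A' B' : is_iso (xMi A' B') by apply: iso_inv_iso.
have ie' A' := eps_iso hH hs A'.
apply: (dist_iso (a := bmap F (eps hH hs A) (eps hH hs B1) \c xMi _ _)
  (b := bmap F (eps hH hs A) (eps hH hs B2) \c xMi _ _)
  (c := bmap F (eps hH hs A) c \c xMi _ _)) d;
  try by apply: is_iso_comp => //; apply: bmap_iso.
- by rewrite -mcompA -xMi_nat fmap_id !mcompA !bmap_comp -eps_nat mcomp_idl mcomp_idr.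
- by rewrite -mcompA -xMi_nat fmap_id !mcompA !bmap_comp c1 mcomp_idl mcomp_idr.
rewrite [in RHS]mcompA -(mcompA (ext_bsr _ _)) bmap_comp c2 mcomp_idl.
have -> : bmap F (eps hH hs A)
    (fmap shift (eps hH hs B1) \c pull_shift H s _ \c fmap (pull H s) h') =
    bmap F (eps hH hs A) (fmap shift (eps hH hs B1))
      \c (bmap F (idm _) (pull_shift H s _) \c bmap F (fmap (pull H s) (idm _)) (fmap (pull H s) h')).
  by rewrite !bmap_comp fmap_id !mcomp_idl mcomp_idr mcompA.
rewrite -!mcompA xMi_nat -(reassoc (ext_bsr_nat _ _)) (mcompA _ (xMi _ _)).
by rewrite (reassoc (ext_bsr_xMi _ _)) !fmap_comp -!mcompA.
Qed.

End Lift.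

(** By descent: at pullbacks along g both composites become g^* of the corresponding composites over
    V, where the sign rule holds. *)
Lemma xF_anti A B :
  fmap shift (ext_bsr A B) \c ext_bsl A (shift B) =
  - (fmap shift (ext_bsl A B) \c ext_bsr (shift A) B
     : phom (F (shift A, shift B)) (shift (shift (F (A, B))))).
Proof.
move: A B; apply: (descent_uniq hH
  (Gm := fun A A' B B' x y => bmap F (fmap shift x) (fmap shift y))
  (Rm := fun A A' B B' x y => fmap shift (fmap shift (bmap F x y)))
  (nu' := fun A B => - (fmap shift (ext_bsl A B) \c ext_bsr (shift A) B
     : phom (F (shift A, shift B)) (shift (shift (F (A, B))))))).
- by move=> *; apply: bmap_iso; apply: fmap_iso.
- move=> A A' B B' x y; lazy beta.
  rewrite mcompA -fmap_comp ext_bsr_nat fmap_comp -!mcompA; congr (_ \c _).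
  by rewrite ext_bsl_nat.
- move=> A A' B B' x y; lazy beta.
  rewrite compNr compNl mcompA -fmap_comp ext_bsl_nat fmap_comp -!mcompA.
  by rewrite ext_bsr_nat.
move=> V g A B.
have i := bmap_iso F (tri_iso (pull_tri H g) A) (tri_iso (pull_tri H g) B).
have j := fmap_iso shift (fmap_iso shift (xM_iso (E X) g A B)).
apply: (iso_epi i); apply: (iso_mono j); rewrite compNl compNr -!mcompA.
have -> : fmap shift (fmap shift (xM (E X) g A B)) \c (fmap shift (ext_bsr (pull H g A) (pull H g B))
    \c (ext_bsl (pull H g A) (shift (pull H g B))
    \c bmap F (pull_shift H g A) (pull_shift H g B))) =
  fmap shift (pull_shift H g _) \c (pull_shift H g _
    \c (fmap (pull H g) (fmap shift (bsr (tt_shift t V) A B) \c bsl (tt_shift t V) A (shift B))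
    \c xM (E X) g (shift A) (shift B))).
  (* Splitting off the second variable on the left lets naturality of [ext_bsl] carry it to
     [ext_bsr]. *)
  have -> : bmap F (pull_shift H g A) (pull_shift H g B) =
      bmap F (fmap shift (idm _)) (pull_shift H g B) \c bmap F (pull_shift H g A) (idm _).
    by rewrite bmap_comp fmap_id mcomp_idl mcomp_idr.
  rewrite -(reassoc (ext_bsl_nat _ _)) !(reassoc1 (esym (fmap_comp shift _ _))).
  rewrite ext_bsrE !fmap_comp -!mcompA ext_bslE -!mcompA.
  by rewrite (reassoc (tri_nat (pull_tri H g) _)).
have -> : fmap shift (fmap shift (xM (E X) g A B)) \c (fmap shift (ext_bsl (pull H g A) (pull H g B))
    \c (ext_bsr (shift (pull H g A)) (pull H g B)
    \c bmap F (pull_shift H g A) (pull_shift H g B))) =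
  fmap shift (pull_shift H g _) \c (pull_shift H g _
    \c (fmap (pull H g) (fmap shift (bsl (tt_shift t V) A B) \c bsr (tt_shift t V) (shift A) B)
    \c xM (E X) g (shift A) (shift B))).
  have -> : bmap F (pull_shift H g A) (pull_shift H g B) =
      bmap F (pull_shift H g A) (fmap shift (idm _)) \c bmap F (idm _) (pull_shift H g B).
    by rewrite bmap_comp fmap_id mcomp_idl mcomp_idr.
  rewrite -(reassoc (ext_bsr_nat _ _)) !(reassoc1 (esym (fmap_comp shift _ _))).
  rewrite ext_bslE !fmap_comp -!mcompA ext_bsrE -!mcompA.
  by rewrite (reassoc (tri_nat (pull_tri H g) _)).
by rewrite (bitri_anti (tt_bitri t V)) (fmapN (tri_additive (pull_tri H g))) compNl !compNr.
Qed.

End Fiber.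
End Bitriangulated.

(** * Restriction to U *)

Lemma natiso_ext (C D : category) (F G : functor C D) (a b : natiso F G) :
  (forall X, a X = b X) -> a = b.
Proof.
case: a b => [[a na] ia la ra] [[b nb] ib lb rb] /= e.
have {}e : a = b by apply: functional_extensionality_dep.
subst b; have ei : ia = ib.
  apply: functional_extensionality_dep => X.
  by rewrite -(mcomp_idr (ia X)) -(rb X) mcompA la mcomp_idl.
subst ib; have en := proof_irrelevance _ na nb; subst nb.
by f_equal; apply: proof_irrelevance.
Qed.

(** The bifunctors are literally those of [t], so the remaining data can be compared value by value
    without transport. *)
Lemma tri_tensor_ext (C : category) (H : tri_fibered C) (t : tri_tensor H)
    (m : forall (T X : C) (f : hom T X), natiso
      (fcomp (tens t T) (Defs.fprod (pull H f) (pull H f))) (fcomp (pull H f) (tens t X)))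
    mc (sh : forall X : C, bishift_family (tens t X)) b mb :
  (forall T X f A B, m T X f (A, B) = tens_m t f (A, B)) ->
  (forall X A B, bsl (sh X) A B = bsl (tt_shift t X) A B) ->
  (forall X A B, bsr (sh X) A B = bsr (tt_shift t X) A B) ->
  @TriTensor C H (@Tensor C _ H (tens t) m mc) sh b mb = t.
Proof.
case: t m mc sh b mb => [[tn m' mc'] sh' b' mb'] /= m mc sh b mb em el er.
have {}em : m = m'.
  do 3 apply: functional_extensionality_dep => ?.
  by apply: natiso_ext => -[A B]; apply: em.
subst m'; have {}es : sh = sh'.
  apply: functional_extensionality_dep => X; move: (el X) (er X).
  case: (sh X) (sh' X) => [l r] [l' r'] /= ll rr.
  have -> : l = l' by do 2 apply: functional_extensionality_dep => ?; apply: ll.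
  by have -> : r = r' by do 2 apply: functional_extensionality_dep => ?; apply: rr.
subst sh'; have e := proof_irrelevance _ mc mc'; subst mc'.
have e := proof_irrelevance _ b b'; subst b'.
by have e := proof_irrelevance _ mb mb'; subst mb'.
Qed.

Lemma tensor_equiv_ext (C : category) (fib : C -> category) (H : fibered fib)
    (t t' : tensor H) (e e' : tensor_equiv t t') :
  (forall X A B, te_iso e X (A, B) = te_iso e' X (A, B)) -> e = e'.
Proof.
case: e e' => [e c] [e' c'] /= ee.
have {}ee : e = e'.
  apply: functional_extensionality_dep => X.
  by apply: natiso_ext => -[A B]; apply: ee.
by subst e'; f_equal; apply: proof_irrelevance.
Qed.

Section Assembly.
Variables (S : base) (H : tri_fibered S) (hH : localic H) (t : tri_tensor (restrictU H)).

Section Tensor.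
Variable E : forall X : S, extension t X.

(** Pairs have no definitional eta, so the component at a variable pair is defined by matching. *)
Definition ext_m_app (T X : S) (f : hom T X) (AB : prod_cat (tfib H X) (tfib H X)) :
    hom (fcomp (xF (E T)) (Defs.fprod (pull H f) (pull H f)) AB)
        (fcomp (pull H f) (xF (E X)) AB) :=
  let: (A, B) as AB := AB return
    hom (fcomp (xF (E T)) (Defs.fprod (pull H f) (pull H f)) AB)
        (fcomp (pull H f) (xF (E X)) AB) in ext_m hH E f A B.

Lemma ext_m_app_nat T X (f : hom T X) AB AB' (xy : hom AB AB') :
  fmap (fcomp (pull H f) (xF (E X))) xy \c ext_m_app f AB =
  ext_m_app f AB' \c fmap (fcomp (xF (E T)) (Defs.fprod (pull H f) (pull H f))) xy.
Proof. by case: AB AB' xy => [A B] [A' B'] [x y]; apply: (ext_m_nat hH E f x y). Qed.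

Lemma ext_m_app_iso T X (f : hom T X) AB : is_iso (ext_m_app f AB).
Proof. by case: AB => A B; apply: (ext_m_iso hH E f A B). Qed.

Definition build_m (T X : S) (f : hom T X) :
    natiso (fcomp (xF (E T)) (Defs.fprod (pull H f) (pull H f))) (fcomp (pull H f) (xF (E X))) :=
  @NatIso _ _ _ _ (NatTrans (@ext_m_app_nat T X f)) (fun AB => iso_inv (ext_m_app_iso f AB))
    (fun AB => iso_invl _) (fun AB => iso_invr _).

Lemma build_m_comp (T X V : S) (f : hom T X) (g : hom X V) (A B : tfib H V) :
  conn H f g (xF (E V) (A, B)) \c build_m (g \c f) (A, B) =
  fmap (pull H f) (build_m g (A, B)) \c build_m f (pull H g A, pull H g B)
    \c bmap (xF (E T)) (conn H f g A) (conn H f g B).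
Proof. by rewrite -!cn_erefl; apply: (ext_m_comp hH E erefl A B). Qed.

Definition build_tensor : tensor H :=
  @Tensor S (fun X => tfib H X) H (fun X => xF (E X)) build_m build_m_comp.

Definition build_shift (X : S) : bishift_family (xF (E X)) :=
  @BiShift _ _ _ (xF (E X)) (ext_bsl hH E (X := X)) (ext_bsr hH E (X := X)).

Lemma build_bitri (X : S) : bitriangulated (build_shift X).
Proof.
have [V [s hs]] := exists_embedding X.
split.
- exact: (xF_addl hH E hs).
- exact: (xF_addr hH E hs).
- by move=> *; apply: ext_bsl_nat.
- by move=> *; apply: ext_bsr_nat.
- exact: ext_bsl_iso.
- exact: ext_bsr_iso.
- exact: xF_anti.
- exact: (xF_distl hH E hs).
- exact: (xF_distr hH E hs).
Qed.

Lemma build_m_bitri (T X : S) (f : hom T X) :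
  bitri_morphism (bishift_pre (build_shift T) (pull_shift H f) (pull_shift H f))
    (bishift_post (pull_shift H f) (build_shift X)) (build_m f).
Proof.
move=> A B; split; apply: etrans (mcompA _ _ _) _.
- exact: (ext_sh_pull hH E (@bslU_nat S H t) (@bslU_pull S H t) f A B).
- exact: (ext_sh_pull hH E (@bsrU_nat S H t) (@bsrU_pull S H t) f A B).
Qed.

Definition build_tri_tensor : tri_tensor H :=
  @TriTensor S H build_tensor build_shift build_bitri build_m_bitri.

End Tensor.

Definition extension_of_tensor (V : Ucat S) : extension t (sval V) :=
  @Extension S H t (sval V) (tU t V) (fun W g A B => @mU S H t V W g A B)
    (fun W g A A' B B' x y => @mU_nat S H t V W g A A' B B' x y)
    (fun W g A B => @mU_iso S H t V W g A B)
    (fun W W' g h k e A B => @mU_comp S H t V W W' g h k e A B).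

(** [EU] is a variable so that its equation can be substituted in the types of [m] and [sh] at once.
    Afterwards descent applies, as the m and shifts of [t] satisfy the same equations. *)
Lemma restrict_unique (EU : forall V : Ucat S, extension t (sval V))
    (m : forall (T V : Ucat S) (f : @hom S (sval T) (sval V)), natiso
      (fcomp (xF (EU T)) (Defs.fprod (pull H f) (pull H f))) (fcomp (pull H f) (xF (EU V))))
    mc (sh : forall V : Ucat S, bishift_family (xF (EU V))) b mb :
  EU = extension_of_tensor ->
  (forall (T V W : Ucat S) (f : @hom S (sval T) (sval V)) (g : @hom S (sval V) (sval W))
     (k : @hom S (sval T) (sval W)) (e : k = g \c f) A B,
     fmap (pull H f) (xM (EU V) g A B) \c (m T V f (pull H g A, pull H g B)
       \c bmap (xF (EU T)) (cn H e A) (cn H e B)) =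
     cn H e (tU t W (A, B)) \c xM (EU T) k A B) ->
  (forall (V W : Ucat S) (g : @hom S (sval V) (sval W)) A B,
     fmap shift (xM (EU V) g A B) \c (bsl (sh V) (pull H g A) (pull H g B)
       \c bmap (xF (EU V)) (pull_shift H g A) (idm (pull H g B))) =
     pull_shift H g (tU t W (A, B)) \c fmap (pull H g) (bsl (tt_shift t W) A B)
       \c xM (EU V) g (shift A) B) ->
  (forall (V W : Ucat S) (g : @hom S (sval V) (sval W)) A B,
     fmap shift (xM (EU V) g A B) \c (bsr (sh V) (pull H g A) (pull H g B)
       \c bmap (xF (EU V)) (idm (pull H g A)) (pull_shift H g B)) =
     pull_shift H g (tU t W (A, B)) \c fmap (pull H g) (bsr (tt_shift t W) A B)
       \c xM (EU V) g A (shift B)) ->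
  @TriTensor (Ucat S) (restrictU H)
    (@Tensor (Ucat S) _ (restrictU H) (fun V => xF (EU V)) m mc) sh b mb = t.
Proof.
move=> eE em el er; subst EU; apply: tri_tensor_ext.
- move=> T V f; apply: (descent_uniq hH
    (Gm := fun A A' B B' x y => bmap (tU t T) (fmap (pull H f) x) (fmap (pull H f) y))
    (Rm := fun A A' B B' x y => fmap (pull H f) (bmap (tU t V) x y))).
  + by move=> *; apply: bmap_iso; apply: fmap_iso.
  + by move=> A A' B B' x y; exact: (@nt_nat _ _ _ _ (m T V f) (A, B) (A', B') (x, y)).
  + by move=> A A' B B' x y; exact: (mU_nat t f x y).
  move=> W g A B.
  apply: (iso_epi (bmap_iso (tU t T) (cn_iso H erefl A) (cn_iso H erefl B))).
  apply: (iso_mono (fmap_iso (pull H f) (mU_iso t g A B))).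
  apply: etrans (em T V W f g _ erefl A B) _; apply: etrans (mU_comp t erefl A B) _.
  exact: esym (mcompA _ _ _).
- move=> V; apply: (descent_uniq hH
    (Gm := fun A A' B B' x y => bmap (tU t V) (fmap shift x) y)
    (Rm := fun A A' B B' x y => fmap shift (bmap (tU t V) x y))).
  + by move=> *; apply: bmap_iso => //; apply: fmap_iso.
  + exact: (bitri_natl (b V)).
  + exact: (bitri_natl (tt_bitri t V)).
  move=> W g A B.
  apply: (iso_epi (bmap_iso (tU t V) (tri_iso (pull_tri H g) A) (is_iso_id (pull H g B)))).
  apply: (iso_mono (fmap_iso shift (mU_iso t g A B))).
  apply: etrans (el V W g A B) _; symmetry; rewrite mcompA; exact: (bslU_pull t g A B).
- move=> V; apply: (descent_uniq hH
    (Gm := fun A A' B B' x y => bmap (tU t V) x (fmap shift y))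
    (Rm := fun A A' B B' x y => fmap shift (bmap (tU t V) x y))).
  + by move=> *; apply: bmap_iso => //; apply: fmap_iso.
  + exact: (bitri_natr (b V)).
  + exact: (bitri_natr (tt_bitri t V)).
  move=> W g A B.
  apply: (iso_epi (bmap_iso (tU t V) (is_iso_id (pull H g A)) (tri_iso (pull_tri H g) B))).
  apply: (iso_mono (fmap_iso shift (mU_iso t g A B))).
  apply: etrans (er V W g A B) _; symmetry; rewrite mcompA; exact: (bsrU_pull t g A B).
Qed.

Lemma restrict_build (E : forall X : S, extension t X) :
  (forall V, E (sval V) = extension_of_tensor V) ->
  restrict_tri_tensor (build_tri_tensor E) = t.
Proof.
move=> e; apply: (restrict_unique (EU := fun V => E (sval V))).
- by apply: functional_extensionality_dep.
- by move=> T V W f g k e' A B; exact: (ext_mE hH E e' A B).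
- by move=> V W g A B; exact: (ext_bslE hH E g A B).
- by move=> V W g A B; exact: (ext_bsrE hH E g A B).
Qed.

Variable ht : localic_tensor (@Usmooth S) t.

(* Over U the chosen extension is [t] itself, so that the restriction is [t] on the
   nose and not merely up to equivalence. *)
Lemma tensor_extension_exists : exists t' : tri_tensor H, restrict_tri_tensor t' = t.
Proof.
have emb (X : S) : inhabited (extension t X).
  have [V [s hs]] := exists_embedding X.
  by split; exact: (embedding_extension hH ht hs).
pose E (X : S) : extension t X :=
  match excluded_middle_informative (in_U X) with
  | left h => extension_of_tensor (exist _ X h)
  | right _ => epsilon (emb X) (fun _ => True)
  end.
exists (build_tri_tensor E); apply: restrict_build => -[X hX]; rewrite /E /=.
case: excluded_middle_informative => // h.
by rewrite (proof_irrelevance _ h hX).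
Qed.

End Assembly.

(** * Uniqueness *)

Section Uniqueness.
Variables (S : base) (H : tri_fibered S) (hH : localic H) (t1 t2 : tri_tensor H).
Variable e0 : tensor_equiv (restrict_tri_tensor t1) (restrict_tri_tensor t2).
Let t := restrict_tri_tensor t1.

Definition e0_app (V : Ucat S) (A B : tfib H (sval V)) :
  hom (tens t1 (sval V) (A, B)) (tens t2 (sval V) (A, B)) := te_iso e0 V (A, B).
Definition e0_inv (V : Ucat S) (A B : tfib H (sval V)) :
  hom (tens t2 (sval V) (A, B)) (tens t1 (sval V) (A, B)) := ni_inv (te_iso e0 V) (A, B).

Lemma e0K (V : Ucat S) (A B : tfib H (sval V)) : e0_inv A B \c e0_app A B = idm _.
Proof. exact: (ni_invl (te_iso e0 V) (A, B)). Qed.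

Lemma e0Ki (V : Ucat S) (A B : tfib H (sval V)) : e0_app A B \c e0_inv A B = idm _.
Proof. exact: (ni_invr (te_iso e0 V) (A, B)). Qed.

Lemma e0_app_iso (V : Ucat S) (A B : tfib H (sval V)) : is_iso (e0_app A B).
Proof. by exists (e0_inv A B); rewrite e0K e0Ki. Qed.

Lemma e0_nat (V : Ucat S) (A A' B B' : tfib H (sval V)) (x : hom A A') (y : hom B B') :
  bmap (tens t2 _) x y \c e0_app A B = e0_app A' B' \c bmap (tens t1 _) x y.
Proof. exact: (@nt_nat _ _ _ _ (te_iso e0 V) (A, B) (A', B') (x, y)). Qed.

Lemma e0_compat (V W : Ucat S) (h : @hom S (sval V) (sval W)) (A B : tfib H (sval W)) :
  tm t2 h A B \c e0_app (pull H h A) (pull H h B) =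
  fmap (pull H h) (e0_app A B) \c tm t1 h A B.
Proof. exact: (@te_compat _ _ _ _ _ e0 V W h A B). Qed.

Section Fiber.
Variable X : S.

(* [t2] seen as an extension of [t1], through the inverse of [e0]. *)
Definition eM (V : Ucat S) (g : @hom S X (sval V)) (A B : tfib H (sval V)) :
    hom (tens t2 X (pull H g A, pull H g B)) (pull H g (tU t V (A, B))) :=
  locked (fmap (pull H g) (e0_inv A B) \c tm t2 g A B).

Lemma eME (V : Ucat S) (g : @hom S X (sval V)) (A B : tfib H (sval V)) :
  fmap (pull H g) (e0_app A B) \c eM g A B = tm t2 g A B.
Proof. by rewrite /eM -lock mcompA -fmap_comp e0Ki fmap_id mcomp_idl. Qed.

Let Fe0 (V : Ucat S) (g : @hom S X (sval V)) (A B : tfib H (sval V)) :=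
  fmap_iso (pull H g) (e0_app_iso A B).

Lemma eM_nat (V : Ucat S) (g : @hom S X (sval V)) A A' B B' (x : hom A A') (y : hom B B') :
  fmap (pull H g) (bmap (tU t V) x y) \c eM g A B =
  eM g A' B' \c bmap (tens t2 X) (fmap (pull H g) x) (fmap (pull H g) y).
Proof.
apply: (iso_mono (Fe0 g A' B')); rewrite !mcompA eME -fmap_comp -e0_nat.
by rewrite fmap_comp -mcompA eME tm_nat.
Qed.

Lemma eM_iso (V : Ucat S) (g : @hom S X (sval V)) A B : is_iso (eM g A B).
Proof. by apply: (is_iso_cancel_l (Fe0 g A B)); rewrite eME; apply: tm_iso. Qed.

Lemma eM_comp (V W : Ucat S) (g : @hom S X (sval V)) (h : @hom S (sval V) (sval W))
    (k : @hom S X (sval W)) (e : k = h \c g) A B :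
  cn H e (tU t W (A, B)) \c eM k A B =
  fmap (pull H g) (mU t h A B) \c eM g (pull H h A) (pull H h B)
    \c bmap (tens t2 X) (cn H e A) (cn H e B).
Proof.
apply: (iso_mono (fmap_iso (pull H g) (fmap_iso (pull H h) (e0_app_iso A B)))).
rewrite !mcompA (cn_nat H e) -mcompA eME -fmap_comp.
have -> : mU t h A B = tm t1 h A B by [].
by rewrite -e0_compat fmap_comp -(mcompA _ _ (eM _ _ _)) eME tm_comp.
Qed.

Definition equiv_extension : extension t X :=
  @Extension S H t X (tens t2 X) eM eM_nat eM_iso eM_comp.

Lemma equiv_coherent : @coherent S H t X _ (fid _) (tens t1 X) (fun V g A B => tm t1 g A B).
Proof.
split=> [V g A A' B B' x y | V W g h k e A B]; first exact: (tm_nat t1 g x y).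
exact: (tm_comp t1 e A B).
Qed.

Definition ext_equiv (A B : tfib H X) : hom (tens t1 X (A, B)) (tens t2 X (A, B)) :=
  @nu S H hH t X equiv_extension _ (fid _) (tens t1 X) (fun V g A B => tm t1 g A B) A B.

Lemma ext_equiv_nat (A A' B B' : tfib H X) (x : hom A A') (y : hom B B') :
  bmap (tens t2 X) x y \c ext_equiv A B = ext_equiv A' B' \c bmap (tens t1 X) x y.
Proof. exact: (nu_nat hH equiv_extension equiv_coherent x y). Qed.

Lemma ext_equiv_iso (A B : tfib H X) : is_iso (ext_equiv A B).
Proof.
have := @nu_iso S H hH t X equiv_extension _ (fid _) (tens t1 X) (fun V g A B => tm t1 g A B).
by apply=> V g A' B'; apply: tm_iso.
Qed.

Lemma ext_equivE (V : Ucat S) (g : @hom S X (sval V)) A B :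
  tm t2 g A B \c ext_equiv (pull H g A) (pull H g B) =
  fmap (pull H g) (e0_app A B) \c tm t1 g A B.
Proof.
rewrite -eME -mcompA; congr (_ \c _).
exact: (nuE hH equiv_extension equiv_coherent g A B).
Qed.

Lemma ext_equiv_uniq (e : forall A B : tfib H X, hom (tens t1 X (A, B)) (tens t2 X (A, B))) :
  (forall (A A' B B' : tfib H X) (x : hom A A') (y : hom B B'),
     bmap (tens t2 X) x y \c e A B = e A' B' \c bmap (tens t1 X) x y) ->
  (forall (V : Ucat S) (g : @hom S X (sval V)) A B,
     tm t2 g A B \c e (pull H g A) (pull H g B) =
     fmap (pull H g) (e0_app A B) \c tm t1 g A B) ->
  forall A B, e A B = ext_equiv A B.
Proof.
move=> n ee; apply: (@nu_uniq S H hH t X equiv_extension _ (fid _) _ _ equiv_coherent e n) => V g A B.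
apply: (iso_mono (Fe0 g A B)); apply: etrans (ee V g A B).
by rewrite -eME -mcompA.
Qed.

Definition ext_equiv_app (AB : prod_cat (tfib H X) (tfib H X)) :
    hom (tens t1 X AB) (tens t2 X AB) :=
  let: (A, B) as AB := AB return hom (tens t1 X AB) (tens t2 X AB) in ext_equiv A B.

Lemma ext_equiv_app_nat AB AB' (xy : hom AB AB') :
  fmap (tens t2 X) xy \c ext_equiv_app AB = ext_equiv_app AB' \c fmap (tens t1 X) xy.
Proof. by case: AB AB' xy => [A B] [A' B'] [x y]; apply: (ext_equiv_nat x y). Qed.

Lemma ext_equiv_app_iso AB : is_iso (ext_equiv_app AB).
Proof. by case: AB => A B; apply: ext_equiv_iso. Qed.

Definition ext_equiv_natiso : natiso (tens t1 X) (tens t2 X) :=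
  @NatIso _ _ _ _ (NatTrans ext_equiv_app_nat) (fun AB => iso_inv (ext_equiv_app_iso AB))
    (fun AB => iso_invl _) (fun AB => iso_invr _).

End Fiber.

Lemma ext_equiv_compat (T X : S) (f : hom T X) (A B : tfib H X) :
  tm t2 f A B \c ext_equiv (pull H f A) (pull H f B) =
  fmap (pull H f) (ext_equiv A B) \c tm t1 f A B.
Proof.
move: A B; apply: (descent_uniq hH
  (Gm := fun A A' B B' x y => bmap (tens t1 T) (fmap (pull H f) x) (fmap (pull H f) y))
  (Rm := fun A A' B B' x y => fmap (pull H f) (bmap (tens t2 X) x y))).
- by move=> *; apply: bmap_iso; apply: fmap_iso.
- move=> A A' B B' x y; lazy beta.
  by rewrite mcompA (tm_nat t2 f) -!mcompA ext_equiv_nat.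
- move=> A A' B B' x y; lazy beta.
  by rewrite mcompA -fmap_comp ext_equiv_nat fmap_comp -!mcompA (tm_nat t1 f).
move=> V g A B; set k := g \c f; have e : k = g \c f by [].
apply: (iso_epi (bmap_iso (tens t1 T) (cn_iso H e A) (cn_iso H e B))).
apply: (iso_mono (fmap_iso (pull H f) (tm_iso t2 g A B))).
rewrite -!mcompA -ext_equiv_nat !mcompA -(tm_comp t2 e) -mcompA ext_equivE.
rewrite -[in RHS]fmap_comp ext_equivE fmap_comp -!mcompA.
by rewrite -(reassoc (cn_nat H e _)) (tm_comp t1 e) -!mcompA.
Qed.

Definition extended_equiv : tensor_equiv t1 t2 :=
  @TensorEquiv S _ H t1 t2 ext_equiv_natiso ext_equiv_compat.

(** [ext_equiv_uniq] gives both halves: over U it applies to e0, so the extension restricts to e0;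
    over S it applies to the components of any e restricting to e0. *)
Lemma tensor_equiv_restrict_unique : exists! e : tensor_equiv t1 t2, restrict_equiv e = e0.
Proof.
exists extended_equiv; split.
  apply: tensor_equiv_ext => V A B.
  symmetry; apply: (ext_equiv_uniq (X := sval V) (e := @e0_app V)); first exact: e0_nat.
  by move=> W g A' B'; apply: e0_compat.
move=> e ee; apply: tensor_equiv_ext => X A B; symmetry.
apply: (ext_equiv_uniq (e := fun A B => te_iso e X (A, B))).
  by move=> A1 A2 B1 B2 x y; exact: (@nt_nat _ _ _ _ (te_iso e X) (A1, B1) (A2, B2) (x, y)).
move=> V g A1 B1; rewrite /e0_app -ee.
exact: (te_compat e g A1 B1).
Qed.

End Uniqueness.

(** * The projection formulas *)

Section BaseChange.
Variables (S : base) (H : tri_fibered S) (t : tri_tensor H).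
Variables (P' P T B : S) (f' : hom P' P) (p' : hom P' T) (p : hom P B) (f : hom T B).
Variable e : p \c f' = f \c p'.

Definition swap A : @hom (tfib H P') (pull H f' (pull H p A)) (pull H p' (pull H f A)) :=
  locked (square_swap e A).

Lemma swap_cn A : swap A \c cn H (erefl (p \c f')) A = cn H e A.
Proof.
rewrite cn_erefl /cn /swap -!lock /square_swap -[LHS]mcompA -[RHS]mcomp_idr.
by congr (_ \c _); exact: (ni_invl (conn H f' p) A).
Qed.

Lemma swap_nat A A' (x : hom A A') :
  fmap (pull H p') (fmap (pull H f) x) \c swap A =
  swap A' \c fmap (pull H f') (fmap (pull H p) x).
Proof.
apply: (iso_epi (cn_iso H (erefl (p \c f')) A)); rewrite -!mcompA swap_cn.
by rewrite !cn_nat mcompA swap_cn.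
Qed.

Lemma swap_tm A A' :
  swap (tens t B (A, A')) \c (fmap (pull H f') (tm t p A A')
    \c tm t f' (pull H p A) (pull H p A')) =
  fmap (pull H p') (tm t f A A') \c (tm t p' (pull H f A) (pull H f A')
    \c bmap (tens t P') (swap A) (swap A')).
Proof.
apply: (iso_epi (bmap_iso (tens t P') (cn_iso H (erefl (p \c f')) A) (cn_iso H (erefl (p \c f')) A'))).
rewrite -[LHS]mcompA -(tm_comp t (erefl (p \c f'))) mcompA swap_cn.
by rewrite -!mcompA bmap_comp !swap_cn (tm_comp t e) -!mcompA.
Qed.

Variables (L : functor (tfib H P) (tfib H B)) (adj : adjunction L (pull H p)).
Variables (L' : functor (tfib H P') (tfib H T)) (adj' : adjunction L' (pull H p')).

(** Passing to adjuncts removes the counits from base change and from the projection formulas. *)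
Lemma transpose_base_change A :
  transpose adj' (base_change e adj adj' A) = swap (L A) \c fmap (pull H f') (adj_unit adj A).
Proof. by rewrite /swap -lock /base_change -mcompA -fmap_comp transpose_counit. Qed.

Lemma transpose_proj_formula_l A A' :
  transpose adj (proj_formula_l t adj A A') =
  tm t p (L A) A' \c bmap (tens t P) (adj_unit adj A) (idm (pull H p A')).
Proof. by rewrite /proj_formula_l -mcompA -fmap_comp transpose_counit. Qed.

Lemma transpose_proj_formula_r A A' :
  transpose adj (proj_formula_r t adj A A') =
  tm t p A (L A') \c bmap (tens t P) (idm (pull H p A)) (adj_unit adj A').
Proof. by rewrite /proj_formula_r -mcompA -fmap_comp transpose_counit. Qed.

End BaseChange.

Section ProjectionBaseChange.
Variables (S : base) (H : tri_fibered S) (hH : localic H) (t : tri_tensor H).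
Variables (P' P T B : S) (f' : hom P' P) (p' : hom P' T) (p : hom P B) (f : hom T B).
Variables (c : cartesian f' p' p f) (sp : smooth p).
Variables (L : functor (tfib H P) (tfib H B)) (adj : adjunction L (pull H p)).
Variables (L' : functor (tfib H P') (tfib H T)) (adj' : adjunction L' (pull H p')).
Let e := proj1 c.

(** Both sides start at a value of L', so adjuncts suffice. There the identity reduces to the
    compatibility [swap_tm] of m with the commutative square. *)
Lemma proj_formula_l_base_change A A' :
  fmap (pull H f) (proj_formula_l t adj A A')
    \c (base_change e adj adj' (tens t P (A, pull H p A'))
    \c fmap L' (tm t f' A (pull H p A'))) =
  tm t f (L A) A' \c (bmap (tens t T) (base_change e adj adj' A) (idm (pull H f A'))
    \c (proj_formula_l t adj' (pull H f' A) (pull H f A')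
    \c fmap L' (bmap (tens t P') (idm (pull H f' A)) (swap e A')))).
Proof.
apply: (transpose_inj (adj := adj')).
rewrite [LHS](transpose_compl adj') [X in _ \c X = _](transpose_compr adj').
rewrite transpose_base_change [RHS](transpose_compl adj').
rewrite [X in _ = _ \c X](transpose_compl adj').
rewrite [X in _ = _ \c (_ \c X)](transpose_compr adj') transpose_proj_formula_l.
rewrite -!mcompA (reassoc (swap_nat e _)).
have -> : fmap (pull H f') (fmap (pull H p) (proj_formula_l t adj A A'))
    \c (fmap (pull H f') (adj_unit adj _) \c tm t f' A (pull H p A')) =
  fmap (pull H f') (tm t p (L A) A') \c (tm t f' (pull H p (L A)) (pull H p A')
    \c bmap (tens t P') (fmap (pull H f') (adj_unit adj A)) (idm _)).
  rewrite (reassoc1 (esym (fmap_comp (pull H f') _ _))).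
  rewrite [X in fmap _ X](transpose_proj_formula_l t adj A A') fmap_comp -mcompA.
  by rewrite (tm_nat t f') fmap_id.
rewrite !mcompA -(mcompA _ _ (tm t f' _ _)) swap_tm -!mcompA.
rewrite !bmap_comp !(reassoc (tm_nat t p' _ _)) fmap_id !bmap_comp.
have ebc : fmap (pull H p') (base_change e adj adj' A) \c adj_unit adj' (pull H f' A) =
    swap e (L A) \c fmap (pull H f') (adj_unit adj A) := transpose_base_change _ _ _ _.
by rewrite !mcomp_idl !mcomp_idr ebc.
Qed.

Lemma proj_formula_r_base_change A A' :
  fmap (pull H f) (proj_formula_r t adj A A')
    \c (base_change e adj adj' (tens t P (pull H p A, A'))
    \c fmap L' (tm t f' (pull H p A) A')) =
  tm t f A (L A') \c (bmap (tens t T) (idm (pull H f A)) (base_change e adj adj' A')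
    \c (proj_formula_r t adj' (pull H f A) (pull H f' A')
    \c fmap L' (bmap (tens t P') (swap e A) (idm (pull H f' A'))))).
Proof.
apply: (transpose_inj (adj := adj')).
rewrite [LHS](transpose_compl adj') [X in _ \c X = _](transpose_compr adj').
rewrite transpose_base_change [RHS](transpose_compl adj').
rewrite [X in _ = _ \c X](transpose_compl adj').
rewrite [X in _ = _ \c (_ \c X)](transpose_compr adj') transpose_proj_formula_r.
rewrite -!mcompA (reassoc (swap_nat e _)).
have -> : fmap (pull H f') (fmap (pull H p) (proj_formula_r t adj A A'))
    \c (fmap (pull H f') (adj_unit adj _) \c tm t f' (pull H p A) A') =
  fmap (pull H f') (tm t p A (L A')) \c (tm t f' (pull H p A) (pull H p (L A'))
    \c bmap (tens t P') (idm _) (fmap (pull H f') (adj_unit adj A'))).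
  rewrite (reassoc1 (esym (fmap_comp (pull H f') _ _))).
  rewrite [X in fmap _ X](transpose_proj_formula_r t adj A A') fmap_comp -mcompA.
  by rewrite (tm_nat t f') fmap_id.
rewrite !mcompA -(mcompA _ _ (tm t f' _ _)) swap_tm -!mcompA.
rewrite !bmap_comp !(reassoc (tm_nat t p' _ _)) fmap_id !bmap_comp.
have ebc : fmap (pull H p') (base_change e adj adj' A') \c adj_unit adj' (pull H f' A') =
    swap e (L A') \c fmap (pull H f') (adj_unit adj A') := transpose_base_change _ _ _ _.
by rewrite !mcomp_idl !mcomp_idr ebc.
Qed.

Lemma pull_proj_formula_iso A A' :
  (is_iso (proj_formula_l t adj' (pull H f' A) (pull H f A')) ->
   is_iso (fmap (pull H f) (proj_formula_l t adj A A'))) /\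
  (is_iso (proj_formula_r t adj' (pull H f A') (pull H f' A)) ->
   is_iso (fmap (pull H f) (proj_formula_r t adj A' A))).
Proof.
have ibc X : is_iso (base_change e adj adj' X) := loc_base_change hH c sp adj adj' X.
have isw X : is_iso (swap (H := H) e X) by rewrite /swap -lock; apply: square_swap_iso.
split=> i.
- apply: is_iso_cancel_r (is_iso_comp (ibc _) (fmap_iso L' (tm_iso t f' A (pull H p A')))) _.
  rewrite proj_formula_l_base_change; apply: is_iso_comp; first exact: tm_iso.
  apply: is_iso_comp; first by apply: bmap_iso => //; apply: is_iso_id.
  by apply: is_iso_comp => //; apply: fmap_iso; apply: bmap_iso => //; apply: is_iso_id.
- apply: is_iso_cancel_r (is_iso_comp (ibc _) (fmap_iso L' (tm_iso t f' (pull H p A') A))) _.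
  rewrite proj_formula_r_base_change; apply: is_iso_comp; first exact: tm_iso.
  apply: is_iso_comp; first by apply: bmap_iso => //; apply: is_iso_id.
  by apply: is_iso_comp => //; apply: fmap_iso; apply: bmap_iso => //; apply: is_iso_id.
Qed.

End ProjectionBaseChange.

Section LocalicTensor.
Variables (S : base) (H : tri_fibered S) (hH : localic H) (t : tri_tensor H).
Hypothesis hU : localic_tensor (@Usmooth S) (restrict_tri_tensor t).

Definition proj_formulas (X : S) : Prop :=
  forall (P : S) (p : hom P X), smooth p ->
  forall (L : functor (tfib H P) (tfib H X)) (adj : adjunction L (pull H p)),
    (forall A B, is_iso (proj_formula_l t adj A B)) /\
    (forall A B, is_iso (proj_formula_r t adj A B)).

(** The source of a smooth morphism to an object of U is again in U, so the assumption over U covers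
    every [p]. *)
Lemma proj_formulas_U (X : S) : in_U X -> proj_formulas X.
Proof.
move=> uX P p sp L adj.
have uP : in_U P by rewrite /in_U -(to_pt_uniq (to_pt X \c p)); apply: smooth_comp.
exact: (hU (P := exist _ P uP) (S := exist _ X uX) sp adj).
Qed.

Lemma proj_formulas_empty : proj_formulas (empty S).
Proof.
by move=> P p sp L adj; split=> A B; apply: zero_iso; apply: loc_empty hH _.
Qed.

Lemma proj_formulas_glue (Z X : S) (z : hom Z X) (hz : closed_imm z) :
  proj_formulas Z -> proj_formulas (compl hz) -> proj_formulas X.
Proof.
move=> hZ hC P p sp L adj.
have [P1 [z1 [p1 c1]]] := smooth_pb_ex z sp.
have [P2 [z2 [p2 c2]]] := smooth_pb_ex (compl_imm hz) sp.
have sp1 := smooth_pb c1 sp; have sp2 := smooth_pb c2 sp.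
have [L1 [adj1]] := loc_sharp hH sp1; have [L2 [adj2]] := loc_sharp hH sp2.
have [h1l h1r] := hZ _ _ sp1 _ adj1; have [h2l h2r] := hC _ _ sp2 _ adj2.
split=> A B; apply: (loc_conservative hH (hz := hz)).
- exact: (pull_proj_formula_iso hH t c1 sp adj adj1 A B).1.
- exact: (pull_proj_formula_iso hH t c2 sp adj adj2 A B).1.
- exact: (pull_proj_formula_iso hH t c1 sp adj adj1 B A).2.
- exact: (pull_proj_formula_iso hH t c2 sp adj adj2 B A).2.
Qed.

Lemma localic_of_restrict : localic_tensor (@smooth S) t.
Proof.
move=> P X; have [n [Z [Z0 Zn strat]]] := base_strat X.
(* [Z r] stands for Z_{r-1}: the induction starts at the empty object and ends at index n + 1. The
   bound r + 1 <= n + 1 is the r <= n needed for the next stratum. *)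
suff h r : (r <= n.+1)%N -> proj_formulas (Z r) by have := h n.+1 (leqnn _); rewrite Zn; apply.
elim: r => [|r IH] hr; first by rewrite Z0; apply: proj_formulas_empty.
have [z [hz sz]] := strat r hr.
by apply: (proj_formulas_glue (hz := hz)); [apply: IH; apply: ltnW | apply: proj_formulas_U].
Qed.

End LocalicTensor.

Theorem theorem3p1 (S : base) (H : tri_fibered S) (hH : localic H)
    (t : tri_tensor (restrictU H)) (ht : localic_tensor (@Usmooth S) t) :
  (exists t' : tri_tensor H, restrict_tri_tensor t' = t) /\
  (forall (t1 t2 : tri_tensor H)
      (h1 : restrict_tri_tensor t1 = t) (h2 : restrict_tri_tensor t2 = t),
    exists! e : tensor_equiv t1 t2,
      restrict_equiv e = tensor_equiv_of_eq (etrans h1 (esym h2))) /\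
  (forall t' : tri_tensor H, restrict_tri_tensor t' = t ->
    localic_tensor (@smooth S) t').
Proof.
split; first exact: (tensor_extension_exists hH ht).
(* The restrictions of t1 and t2 are equal but not convertible; the equivalence induced by the
   equality is the identity over U that gets extended. *)
split=> [t1 t2 h1 h2 | t' e]; first exact: (tensor_equiv_restrict_unique hH).
by apply: (localic_of_restrict hH); rewrite e.
Qed.
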